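(* Let $\mathcal{F}$ be a fixed finite family of graphs and let $c$ be the maximum number of vertices of a graph in $\mathcal{F}$. Then \textsc{Secluded $\mathcal{F}$-free Vertex Deletion} has a problem kernel with $O(k^{c+1})$ vertices.
   Context: A graph is $\mathcal{F}$-free if it contains no induced subgraph isomorphic to a graph in $\mathcal{F}$. \textsc{Secluded $\mathcal{F}$-free Vertex Deletion}: given a graph $G=(V,E)$ and an integer $k$, decide whether there is $S\subseteq V$ such that $G-S$ is $\mathcal{F}$-free and $|N_G[S]|\le k$, where $N_G[S]=S\cup\bigcup_{v\in S}N_G(v)$. A problem kernel is a polynomial-time algorithm mapping an instance $(G,k)$ to an equivalent instance $(G',k')$ of the same problem whose size is bounded by a function of $k$ (here, $G'$ has $O(k^{c+1})$ vertices). *)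

(* Defs.v *)
From Stdlib Require List.
From mathcomp Require Import all_boot.
Unset Printing Implicit Defensive.

Record graph := Graph { gn : nat; gadj : rel 'I_gn }.
Arguments gadj : clear implicits.

Definition simple (G : graph) : Prop :=
  (forall u v, gadj G u v = gadj G v u) /\ (forall u, gadj G u u = false).

Definition contains_induced (G : graph) (X : {set 'I_(gn G)}) (H : graph) : Prop :=
  exists phi : 'I_(gn H) -> 'I_(gn G),
    injective phi /\ (forall i, phi i \in X) /\
    (forall i j, gadj H i j = gadj G (phi i) (phi j)).

Definition free_after_deletion (F : seq graph) (G : graph) (S : {set 'I_(gn G)}) : Prop :=
  forall H, List.In H F -> ~ contains_induced G (~: S) H.

Definition closed_nbhd (G : graph) (S : {set 'I_(gn G)}) : {set 'I_(gn G)} :=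
  S :|: [set v | [exists u in S, gadj G u v]].

Definition secluded_yes (F : seq graph) (G : graph) (k : nat) : Prop :=
  exists S : {set 'I_(gn G)},
    free_after_deletion F G S /\ #|closed_nbhd G S| <= k.

Definition max_order (F : seq graph) : nat := \max_(H <- F) gn H.

(* Tape alphabet: option bool (None = blank).  States 'I_(n.+2); the start
   state is ord0 and the (absorbing) halting state is ord_max. *)
Inductive move := MoveL | MoveR | MoveS.

Record TM := mkTM {
  tm_n : nat;
  tm_delta : 'I_tm_n.+2 -> option bool -> 'I_tm_n.+2 * option bool * move }.

Record config (M : TM) := Config {
  c_state : 'I_(tm_n M).+2;
  c_left : seq (option bool);   (* cells left of head, nearest first *)
  c_cur : option bool;
  c_right : seq (option bool) }.
Arguments Config {M}.
Arguments c_state {M}.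
Arguments c_left {M}.
Arguments c_cur {M}.
Arguments c_right {M}.
Arguments tm_delta : clear implicits.

Definition tm_step (M : TM) (c : config M) : config M :=
  if c_state c == ord_max then c else
  let: (q', w, m) := tm_delta M (c_state c) (c_cur c) in
  match m with
  | MoveL => match c_left c with
             | [::] => Config q' [::] None (w :: c_right c)
             | x :: l => Config q' l x (w :: c_right c)
             end
  | MoveR => match c_right c with
             | [::] => Config q' (w :: c_left c) None [::]
             | x :: r => Config q' (w :: c_left c) x r
             end
  | MoveS => Config q' (c_left c) w (c_right c)
  end.

Definition tm_run (M : TM) (t : nat) (c : config M) : config M := iter t (tm_step M) c.

Definition tm_init (M : TM) (x : seq bool) : config M :=
  match x with
  | [::] => Config ord0 [::] None [::]
  | b :: r => Config ord0 [::] (Some b) (map Some r)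
  end.

Definition tm_output (M : TM) (c : config M) : seq bool :=
  let s := c_cur c :: c_right c in
  map (odflt false) (take (find (fun o => o == None) s) s).

Definition tm_computes_within (M : TM) (x : seq bool) (T : nat) (y : seq bool) : Prop :=
  exists2 t, t <= T &
    let c := tm_run M t (tm_init M x) in
    c_state c = ord_max /\ tm_output M c = y.

Definition enc_instance (G : graph) (k : nat) : seq bool :=
  nseq (gn G) true ++ false ::
  [seq gadj G i j | i <- enum 'I_(gn G), j <- enum 'I_(gn G)] ++ nseq k true.

Definition has_kernel_with_vertex_bound (F : seq graph) (e : nat) : Prop :=
  exists (M : TM) (a d C : nat) (g : nat -> nat),
    forall (G : graph) (k : nat), simple G ->
      exists (G' : graph) (k' : nat),
        [/\ simple G',
            tm_computes_within M (enc_instance G k)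
              (a * (size (enc_instance G k)).+1 ^ d) (enc_instance G' k'),
            secluded_yes F G k <-> secluded_yes F G' k',
            gn G' <= C * k.+1 ^ e
          & k' <= g k].

(* Main.v *)
Require Import Defs.
From Stdlib Require List.
From Stdlib Require Import ZArith FunctionalExtensionality.
From mathcomp Require Import all_boot.
From mathcomp Require Import zify.
Set Implicit Arguments. Unset Strict Implicit. Unset Printing Implicit Defensive.

(** For t in V^c call t bad if its entries span a copy of some H in F.  Going
    through all tuples, keep a bad tuple t unless, for some I, already
    (c (k+1))^(c - #|I|) kept tuples agree with t on I.  At most (c (k+1))^c
    tuples are kept, and by pigeonhole a set of at most k vertices that meets all
    kept tuples meets all bad ones.  The kernel is induced by the vertices of the
    kept tuples and the first k neighbours of each of them: a solution may be
    restricted to vertices of kept tuples, and such a vertex either keeps all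
    its neighbours or has too large a closed neighbourhood in the kernel.

    The greedy procedure is written in a small loop language with natural-number
    variables and one bit array.  Its programs run on a register machine, which
    in turn runs on the tape cut into blocks: a register with value b is a flag
    in block b.  Blank cells are unset flags, so no memory bound is needed, and
    running times stay polynomial at each translation. *)

(** * Structured code for Turing machines *)

(** The caps grow by the factor c (k+1) with each coordinate that is given up. A set D of at most k
    vertices can meet a tuple in at most c k ways, a position together with a vertex of D. If D
    misses a rejected tuple but meets all the kept ones that agree with it on I, these split into at
    most c k subclasses with one more common entry, too few for a class that has reached its cap.
    The last factor k+1 of the vertex bound counts a core vertex with its first k neighbours: were
    all k present, the closed neighbourhood would already have k+1 elements. The budget k itself
    stays the same. Polynomial time rests on F, and hence c, being fixed: the c nested loops, the
    quantifier over index sets I and the tests against F are unrolled into the program text, and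
    only vertices and addresses are handled at run time. The chain of languages is there because the
    single-tape machine has to be exhibited together with its time bound. *)

Definition tape := ((Z -> option bool) * Z)%type.

Definition tmove (m : move) (h : Z) : Z :=
  match m with MoveL => h - 1 | MoveR => h + 1 | MoveS => h end%Z.

Definition tput (f : Z -> option bool) (h : Z) (o : option bool) : Z -> option bool :=
  fun z => if Z.eqb z h then o else f z.

Inductive code :=
| CSkip
| CMove of move
| CWrite of option bool
| CSeq of code & code
| CIf of (option bool -> bool) & code & code
| CWhile of (option bool -> bool) & code.

(** The times are exact step counts of the flat code: one step for a test, and one more for the jump
    over the else branch or back to the loop test. *)
Inductive cexec : code -> tape -> tape -> nat -> Prop :=
| XSkip x : cexec CSkip x x 0
| XMove m f h : cexec (CMove m) (f, h) (f, tmove m h) 1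
| XWrite o f h : cexec (CWrite o) (f, h) (tput f h o, h) 1
| XSeq c1 c2 x y z t1 t2 :
    cexec c1 x y t1 -> cexec c2 y z t2 -> cexec (CSeq c1 c2) x z (t1 + t2)
| XIfT (p : option bool -> bool) c1 c2 x y t :
    p (x.1 x.2) -> cexec c1 x y t -> cexec (CIf p c1 c2) x y t.+2
| XIfF (p : option bool -> bool) c1 c2 x y t :
    ~~ p (x.1 x.2) -> cexec c2 x y t -> cexec (CIf p c1 c2) x y t.+1
| XWhileT (p : option bool -> bool) c x y z t1 t2 :
    p (x.1 x.2) -> cexec c x y t1 -> cexec (CWhile p c) y z t2 ->
    cexec (CWhile p c) x z (t1 + t2).+2
| XWhileF (p : option bool -> bool) c x : ~~ p (x.1 x.2) -> cexec (CWhile p c) x x 1.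

Definition instr := (option bool -> option bool * move * nat)%type.

Definition goto (f : option bool -> nat) : instr := fun o => (o, MoveS, f o).

Fixpoint csize (c : code) : nat :=
  match c with
  | CSkip => 0
  | CMove _ | CWrite _ => 1
  | CSeq c1 c2 => csize c1 + csize c2
  | CIf _ c1 c2 => (csize c1 + csize c2).+2
  | CWhile _ c => (csize c).+2
  end.

Fixpoint flatten_code (c : code) (pc : nat) : seq instr :=
  match c with
  | CSkip => [::]
  | CMove m => [:: fun o => (o, m, pc.+1)]
  | CWrite o => [:: fun _ => (o, MoveS, pc.+1)]
  | CSeq c1 c2 => flatten_code c1 pc ++ flatten_code c2 (pc + csize c1)
  | CIf p c1 c2 =>
      goto (fun o => if p o then pc.+1 else (pc + csize c1).+2)
      :: flatten_code c1 pc.+1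
      ++ goto (fun=> (pc + csize c1 + csize c2).+2)
      :: flatten_code c2 (pc + csize c1).+2
  | CWhile p c =>
      goto (fun o => if p o then pc.+1 else (pc + csize c).+2)
      :: flatten_code c pc.+1 ++ [:: goto (fun=> pc)]
  end.

Lemma size_flatten_code c pc : size (flatten_code c pc) = csize c.
Proof.
elim: c pc => //= [c1 IH1 c2 IH2|p c1 IH1 c2 IH2|p c IH] pc.
- by rewrite size_cat IH1 IH2.
- by rewrite size_cat /= IH1 IH2 addnS.
- by rewrite size_cat /= IH addn1.
Qed.

Definition fstep (P : seq instr) (x : nat * tape) : nat * tape :=
  if x.1 < size P then
    let: (w, m, q) := nth (fun o => (o, MoveS, 0)) P x.1 (x.2.1 x.2.2) in
    (q, (tput x.2.1 x.2.2 w, tmove m x.2.2))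
  else x.

Lemma tput_id f h : tput f h (f h) = f.
Proof.
by apply: functional_extensionality => z; rewrite /tput; case: Z.eqb_spec => [->|].
Qed.

Lemma fstep_at A (i : instr) B x :
  fstep (A ++ i :: B) (size A, x) =
  let: (w, m, q) := i (x.1 x.2) in (q, (tput x.1 x.2 w, tmove m x.2)).
Proof. by rewrite /fstep /= size_cat /= -{1}[size A]addn0 ltn_add2l nth_cat ltnn subnn. Qed.

(** Jump targets are absolute, so code is correct only at the address it was generated for. The
    arbitrary surroundings [A] and [B] make the induction hypotheses apply to subprograms. *)
Lemma flatten_codeP c x y t : cexec c x y t ->
  forall A B, iter t (fstep (A ++ flatten_code c (size A) ++ B)) (size A, x)
            = (size A + csize c, y).
Proof.
elim => {c x y t}.
- by move=> x A B /=; rewrite addn0.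
- by move=> m f h A B; rewrite /= fstep_at /= tput_id addn1.
- by move=> o f h A B; rewrite /= fstep_at /= addn1.
- move=> c1 c2 x y z t1 t2 _ IH1 _ IH2 A B.
  rewrite addnC iterD /= -catA IH1.
  have := IH2 (A ++ flatten_code c1 (size A)) B.
  by rewrite size_cat size_flatten_code -catA addnA.
- move=> p c1 c2 x y t px _ IH A B.
  rewrite iterS iterSr /= fstep_at /= px tput_id -surjective_pairing.
  have := IH (rcons A (goto (fun o => if p o then (size A).+1
            else (size A + csize c1).+2)))
    (goto (fun=> (size A + csize c1 + csize c2).+2)
      :: flatten_code c2 (size A + csize c1).+2 ++ B).
  rewrite size_rcons cat_rcons -catA /= => ->.
  set i := goto _; set j := goto _.
  have -> : A ++ i :: flatten_code c1 (size A).+1 ++ j ::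
      flatten_code c2 (size A + csize c1).+2 ++ B
    = (A ++ i :: flatten_code c1 (size A).+1) ++ j ::
      flatten_code c2 (size A + csize c1).+2 ++ B by rewrite -catA.
  have -> : (size A).+1 + csize c1 = size (A ++ i :: flatten_code c1 (size A).+1).
    by rewrite size_cat /= size_flatten_code addnS.
  rewrite fstep_at /= tput_id -surjective_pairing; congr pair; lia.
- move=> p c1 c2 x y t px _ IH A B.
  rewrite iterSr /= fstep_at /= (negbTE px) tput_id -surjective_pairing.
  set i := goto _; set j := goto _.
  have := IH (A ++ i :: rcons (flatten_code c1 (size A).+1) j) B.
  rewrite size_cat /= size_rcons size_flatten_code -!catA /= cat_rcons.
  rewrite !addnS => ->; congr pair; lia.
- move=> p c x y z t1 t2 px _ IH1 _ IH2 A B.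
  have -> : (t1 + t2).+2 = t2 + (t1.+2) by lia.
  rewrite iterD iterS iterSr /= fstep_at /= px tput_id -surjective_pairing.
  set i := goto _; set j := goto _.
  have := IH1 (rcons A i) (j :: B).
  rewrite size_rcons cat_rcons -catA /= => ->.
  have -> : (size A).+1 + csize c = size (A ++ i :: flatten_code c (size A).+1).
    by rewrite size_cat /= size_flatten_code addnS.
  have -> : A ++ i :: flatten_code c (size A).+1 ++ j :: B
    = (A ++ i :: flatten_code c (size A).+1) ++ j :: B by rewrite -catA.
  rewrite fstep_at /= tput_id -surjective_pairing.
  by have := IH2 A B; rewrite /= -!catA.
- move=> p c x px A B.
  rewrite /= fstep_at /= (negbTE px) tput_id -surjective_pairing; congr pair; lia.
Qed.

Definition machine_of (P : seq instr) : TM :=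
  @mkTM (size P).-1 (fun q o =>
    let: (w, m, q') := nth (fun o => (o, MoveS, 0)) P q o in (inord q', w, m)).

(** Reading with default [None] continues the finite lists by blanks, so configurations that differ
    only in outer blanks represent the same tape. *)
Definition represents {M : TM} (c : config M) (x : nat * tape) : Prop :=
  [/\ c_state c = x.1 :> nat,
      c_cur c = x.2.1 x.2.2,
      forall i, nth None (c_left c) i = x.2.1 (x.2.2 - 1 - Z.of_nat i)%Z
    & forall i, nth None (c_right c) i = x.2.1 (x.2.2 + 1 + Z.of_nat i)%Z].

(** Keeps the [inord] in [machine_of] faithful: a larger target would not be a state. *)
Definition closed_targets (P : seq instr) : Prop :=
  forall i o, i < size P ->
    (nth (fun o => (o, MoveS, 0)) P i o).2 <= size P.

Lemma tput_ne f h o z : z <> h -> tput f h o z = f z.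
Proof. by rewrite /tput; case: Z.eqb_spec. Qed.

Lemma tput_eq f h o : tput f h o h = o.
Proof. by rewrite /tput Z.eqb_refl. Qed.

Lemma machine_of_step P (c : config (machine_of P)) x : 0 < size P ->
  closed_targets P -> x.1 <= size P ->
  represents c x ->
  represents (tm_step _ c) (fstep P x) /\ (fstep P x).1 <= size P.
Proof.
move=> P0 clP xP; case: c => q l cur r [/= qx curx lx rx].
rewrite /tm_step /fstep /=.
have -> : (q == ord_max) = (x.1 == size P).
  by rewrite -val_eqE /= qx prednK.
case: eqP => [xE|xN]; first by rewrite xE ltnn; split.
have xlt : x.1 < size P by lia.
rewrite xlt -curx qx.
have := clP x.1 cur xlt.
case: (nth _ P x.1 cur) => [[w m] q'] /= q'P.
have q'E : (inord q' : 'I_(size P).-1.+2) = q' :> nat by rewrite inordK // prednK.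
split=> //; case: m.
- case: l lx => [|a l] lx; split=> //=.
  + by rewrite tput_ne; [have := lx 0; rewrite /= => ->; congr (x.2.1 _); lia | lia].
  + move=> i; rewrite nth_nil tput_ne; last by lia.
    by have := lx i.+1; rewrite nth_nil => ->; congr (x.2.1 _); lia.
  + case=> [|i] /=; first by rewrite -[LHS](tput_eq x.2.1 x.2.2); congr tput; lia.
    by rewrite tput_ne; [rewrite rx; congr (x.2.1 _); lia | lia].
  + by rewrite tput_ne; [have := lx 0; rewrite /= => ->; congr (x.2.1 _); lia | lia].
  + move=> i; rewrite tput_ne; last by lia.
    by have /= := lx i.+1 => ->; congr (x.2.1 _); lia.
  + case=> [|i] /=; first by rewrite -[LHS](tput_eq x.2.1 x.2.2); congr tput; lia.
    by rewrite tput_ne; [rewrite rx; congr (x.2.1 _); lia | lia].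
- case: r rx => [|a r] rx; split=> //=.
  + by rewrite tput_ne; [have := rx 0; rewrite /= => ->; congr (x.2.1 _); lia | lia].
  + case=> [|i] /=; first by rewrite -[LHS](tput_eq x.2.1 x.2.2); congr tput; lia.
    by rewrite tput_ne; [rewrite lx; congr (x.2.1 _); lia | lia].
  + move=> i; rewrite nth_nil tput_ne; last by lia.
    by have := rx i.+1; rewrite nth_nil => ->; congr (x.2.1 _); lia.
  + by rewrite tput_ne; [have := rx 0; rewrite /= => ->; congr (x.2.1 _); lia | lia].
  + case=> [|i] /=; first by rewrite -[LHS](tput_eq x.2.1 x.2.2); congr tput; lia.
    by rewrite tput_ne; [rewrite lx; congr (x.2.1 _); lia | lia].
  + move=> i; rewrite tput_ne; last by lia.
    by have /= := rx i.+1 => ->; congr (x.2.1 _); lia.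
- split=> //=; first by rewrite tput_eq.
  + by move=> i; rewrite tput_ne; [rewrite lx|lia].
  + by move=> i; rewrite tput_ne; [rewrite rx|lia].
Qed.

Lemma flatten_code_targets c pc i o : i < csize c ->
  (nth (fun o => (o, MoveS, 0)) (flatten_code c pc) i o).2 <= pc + csize c.
Proof.
elim: c pc i => //=.
- by move=> m pc [|i] //= _; lia.
- by move=> m pc [|i] //= _; lia.
- move=> c1 IH1 c2 IH2 pc i lti; rewrite nth_cat size_flatten_code.
  case: ltnP => h; first by apply: leq_trans (IH1 _ _ h) _; lia.
  apply: leq_trans (IH2 _ _ _) _; lia.
- move=> p c1 IH1 c2 IH2 pc [|i] lti /=; first by case: (p o); lia.
  rewrite nth_cat size_flatten_code.
  case: ltnP => h; first by apply: leq_trans (IH1 _ _ h) _; lia.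
  case e : (i - csize c1) => [|j] /=; first lia.
  apply: leq_trans (IH2 _ _ _) _; lia.
- move=> p c1 IH1 pc [|i] lti /=; first by case: (p o); lia.
  rewrite nth_cat size_flatten_code.
  case: ltnP => h; first by apply: leq_trans (IH1 _ _ h) _; lia.
  case e : (i - csize c1) => [|j] /=; first lia.
  lia.
Qed.

Definition init_tape (x : seq bool) : tape :=
  (fun z => if Z.ltb z 0 then None else onth x (Z.to_nat z), 0%Z).

(* The halting state is the position just behind the flat code. *)
Lemma code_computes (c : code) (x y : seq bool) (f : Z -> option bool) h t :
  0 < csize c ->
  cexec c (init_tape x) (f, h) t ->
  (forall i, f (h + Z.of_nat i)%Z = onth y i) ->
  tm_computes_within (machine_of (flatten_code c 0)) x t y.
Proof.
move=> c0 cx fy; set P := flatten_code c 0.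
have sP : size P = csize c by rewrite size_flatten_code.
have P0 : 0 < size P by rewrite sP.
have clP : closed_targets P.
  by move=> i o; rewrite sP => /(flatten_code_targets 0 o).
have rep0 : represents (tm_init (machine_of P) x) (0, init_tape x).
  have r0 i : nth None (map Some (behead x)) i = onth (behead x) i by rewrite onthE.
  have big (z : Z) : (z < 0)%Z -> (init_tape x).1 z = None.
    by move=> z0 /=; case: Z.ltb_spec => //; lia.
  have pos i : (init_tape x).1 (1 + Z.of_nat i)%Z = onth x i.+1.
    rewrite /init_tape /fst; case: Z.ltb_spec => [|_]; first by lia.
    by congr (onth _ _); lia.
  have lft i : None = (init_tape x).1 ((init_tape x).2 - 1 - Z.of_nat i)%Z.
    by rewrite big // /init_tape /snd; lia.
  case: x r0 {big} pos lft {cx} => [|b x] r0 pos lft; split=> //.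
  - by move=> i; rewrite nth_nil; exact: lft.
  - by move=> i; rewrite nth_nil; symmetry; exact: pos.
  - by move=> i; rewrite nth_nil; exact: lft.
  - by move=> i; rewrite r0 /=; symmetry; exact: pos.
have [rt _] : represents (tm_run _ t (tm_init (machine_of P) x))
      (iter t (fstep P) (0, init_tape x)) /\
      (iter t (fstep P) (0, init_tape x)).1 <= size P.
  rewrite /tm_run; elim: {cx} t => [|t [IH1 IH2]] //=.
  exact: machine_of_step.
have := flatten_codeP cx [::] [::].
rewrite /= cats0 -/P => E; rewrite E in rt.
exists t => //.
case: rt => /= st cur _ rt; split.
  by apply: val_inj => /=; rewrite st prednK // add0n sP.
rewrite /tm_output cur.
set s := _ :: _.
have sE i : nth None s i = onth y i.
  case: i => [|i]; rewrite -fy /s /=; first by congr f; lia.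
  by rewrite rt; congr f; lia.
clearbody s; clear -sE.
elim: y s sE => [|b y IH] [|o s] sE //=.
- by have /= := sE 0 => ->.
- by have := sE 0.
- have /= := sE 0 => ->; congr cons.
  by apply: IH => i; exact: (sE i.+1).
Qed.

(** * A register machine on the tape *)

Record rstate := RState { reg : nat -> nat; ram : nat -> bool; io : seq bool }.

Definition fset (T : Type) (f : nat -> T) (x : nat) (v : T) : nat -> T :=
  fun y => if y == x then v else f y.

Definition set_reg (s : rstate) j v := RState (fset (reg s) j v) (ram s) (io s).
Definition set_mem (s : rstate) p v := RState (reg s) (fset (ram s) p v) (io s).
Definition set_io (s : rstate) l := RState (reg s) (ram s) l.

(** Bits are set but never cleared, which suffices because a kept tuple is never dropped. The string
    is used at its right end only: [RPush] appends, and [RIfPop] branches on empty, last symbol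
    true, last symbol false. *)
Inductive rm :=
| RSkip
| RInc of nat
| RClr of nat
| RSet of nat
| RPush of bool
| RSeq of rm & rm
| RIfEq of nat & nat & rm & rm
| RIfBit of nat & rm & rm
| RIfPop of rm & rm & rm
| RWhileNe of nat & nat & rm.

Inductive rexec : rm -> rstate -> rstate -> nat -> Prop :=
| ESkip s : rexec RSkip s s 0
| EInc j s : rexec (RInc j) s (set_reg s j (reg s j).+1) 1
| EClr j s : rexec (RClr j) s (set_reg s j 0) 1
| ESet j s : rexec (RSet j) s (set_mem s (reg s j) true) 1
| EPush b s : rexec (RPush b) s (set_io s (rcons (io s) b)) 1
| ESeq c1 c2 s1 s2 s3 t1 t2 :
    rexec c1 s1 s2 t1 -> rexec c2 s2 s3 t2 -> rexec (RSeq c1 c2) s1 s3 (t1 + t2)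
| EIfEq i j c1 c2 s s' t :
    rexec (if reg s i == reg s j then c1 else c2) s s' t ->
    rexec (RIfEq i j c1 c2) s s' t.+1
| EIfBit j c1 c2 s s' t :
    rexec (if ram s (reg s j) then c1 else c2) s s' t ->
    rexec (RIfBit j c1 c2) s s' t.+1
| EIfPop0 c0 c1 c2 s s' t :
    io s = [::] -> rexec c0 s s' t -> rexec (RIfPop c0 c1 c2) s s' t.+1
| EIfPop c0 c1 c2 s s' t l b :
    io s = rcons l b -> rexec (if b then c1 else c2) (set_io s l) s' t ->
    rexec (RIfPop c0 c1 c2) s s' t.+1
| EWhileT i j c s1 s2 s3 t1 t2 :
    reg s1 i != reg s1 j -> rexec c s1 s2 t1 -> rexec (RWhileNe i j c) s2 s3 t2 ->
    rexec (RWhileNe i j c) s1 s3 (t1 + t2).+1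
| EWhileF i j c s : reg s i = reg s j -> rexec (RWhileNe i j c) s s 1.

(* Register 0 is never written: its flag marks the first block of the tape. *)
Fixpoint rwf (m : nat) (c : rm) : bool :=
  match c with
  | RSkip | RPush _ => true
  | RInc j | RClr j => 0 < j < m
  | RSet j => j < m
  | RSeq c1 c2 => rwf m c1 && rwf m c2
  | RIfEq i j c1 c2 => [&& i < m, j < m, rwf m c1 & rwf m c2]
  | RIfBit j c1 c2 => [&& j < m, rwf m c1 & rwf m c2]
  | RIfPop c0 c1 c2 => [&& rwf m c0, rwf m c1 & rwf m c2]
  | RWhileNe i j c => [&& i < m, j < m & rwf m c]
  end.

Definition runs (c : code) (x y : tape) (T : nat) : Prop :=
  exists2 t, t <= T & cexec c x y t.

Lemma runsW c x y T T' : runs c x y T -> T <= T' -> runs c x y T'.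
Proof. by case=> t le ex le'; exists t => //; apply: leq_trans le'. Qed.

Lemma runs_seq c1 c2 x y z T1 T2 : runs c1 x y T1 -> runs c2 y z T2 ->
  runs (CSeq c1 c2) x z (T1 + T2).
Proof.
move=> [t1 l1 e1] [t2 l2 e2]; exists (t1 + t2); first exact: leq_add.
exact: XSeq e1 e2.
Qed.

Lemma runs_write f h o : runs (CWrite o) (f, h) (tput f h o, h) 1.
Proof. by exists 1 => //; constructor. Qed.

Lemma runs_if (p : option bool -> bool) c1 c2 x y T :
  runs (if p (x.1 x.2) then c1 else c2) x y T -> runs (CIf p c1 c2) x y T.+2.
Proof.
case: (boolP (p _)) => px [t le e].
  by exists t.+2 => //; constructor.
by exists t.+1; [lia|constructor].
Qed.

Lemma runs_whileF (p : option bool -> bool) c x : ~~ p (x.1 x.2) -> runs (CWhile p c) x x 1.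
Proof. by exists 1 => //; constructor. Qed.

Lemma runs_whileT (p : option bool -> bool) c x y z T1 T2 : p (x.1 x.2) ->
  runs c x y T1 -> runs (CWhile p c) y z T2 -> runs (CWhile p c) x z (T1 + T2).+2.
Proof.
move=> px [t1 l1 e1] [t2 l2 e2]; exists (t1 + t2).+2; first by lia.
exact: XWhileT e1 e2.
Qed.

Fixpoint moves (d : move) (n : nat) : code :=
  if n is n'.+1 then CSeq (CMove d) (moves d n') else CSkip.

Definition displacement (d : move) (n : nat) : Z :=
  match d with MoveL => - Z.of_nat n | MoveR => Z.of_nat n | MoveS => 0 end%Z.

Lemma runs_moves d n f h : runs (moves d n) (f, h) (f, (h + displacement d n)%Z) n.
Proof.
elim: n h => [|n IH] h /=.
  have -> : (h + displacement d 0 = h)%Z by case: d => /=; lia.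
  by exists 0 => //; constructor.
have -> : (h + displacement d n.+1 = tmove d h + displacement d n)%Z by clear; case: d => /=; lia.
by rewrite -(add1n n); apply: runs_seq (IH _); exists 1 => //; constructor.
Qed.

Lemma runs_moves_to d n f h h' T : (h' = h + displacement d n)%Z -> n <= T ->
  runs (moves d n) (f, h) (f, h') T.
Proof. by move=> ->; apply: runsW; exact: runs_moves. Qed.

Definition is_flag (o : option bool) : bool := o == Some true.
Definition not_flag (o : option bool) : bool := o != Some true.

Definition nonblank (o : option bool) : bool := o != None.
Definition walk (d : move) : code := CWhile nonblank (CMove d).

Lemma runs_walkR f n : (forall i, (f (Z.of_nat i) != None) = (i < n)) ->
  runs (walk MoveR) (f, 0%Z) (f, Z.of_nat n) (3 * n + 1).
Proof.
move=> fE.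
have gen d i : i + d = n ->
  runs (walk MoveR) (f, Z.of_nat i) (f, Z.of_nat n) (3 * d + 1).
  elim: d i => [|d IH] i e.
    have -> : i = n by lia.
    by apply: runs_whileF; rewrite /nonblank /= fE ltnn.
  have -> : 3 * d.+1 + 1 = (1 + (3 * d + 1)).+2 by lia.
  apply: (runs_whileT (y := (f, Z.of_nat i.+1))).
  - by rewrite /nonblank /= fE; lia.
  - have -> : Z.of_nat i.+1 = tmove MoveR (Z.of_nat i) by rewrite /tmove; lia.
    by exists 1 => //; constructor.
  - by apply: IH; lia.
by apply: (gen n 0).
Qed.

Lemma runs_walkL f n : (forall i, i < n -> f (Z.of_nat i) != None) -> f (-1)%Z = None ->
  runs (walk MoveL) (f, Z.of_nat n - 1)%Z (f, (-1)%Z) (3 * n + 1).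
Proof.
move=> fE f0; elim: n fE => [|n IH] fE.
  by apply: runs_whileF; rewrite /nonblank /= f0.
have -> : 3 * n.+1 + 1 = (1 + (3 * n + 1)).+2 by lia.
apply: (runs_whileT (y := (f, (Z.of_nat n - 1)%Z))).
- rewrite /fst /snd; have -> : (Z.of_nat n.+1 - 1 = Z.of_nat n)%Z by lia.
  exact: fE.
- have -> : (Z.of_nat n - 1 = tmove MoveL (Z.of_nat n.+1 - 1))%Z by rewrite /tmove; lia.
  by exists 1 => //; constructor.
- by apply: IH => i lt; apply: fE; lia.
Qed.

Section Layout.

Variable m : nat.
Let w := m.+1.

Definition flag (b : bool) : option bool := if b then Some true else None.

Definition bcell (s : rstate) (b j : nat) : bool :=
  if j == m then ram s b else reg s j == b.

Definition bpos (b j : nat) : Z := (- 2 - Z.of_nat (b * w + j))%Z.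

(* The cells z >= 0 hold the input/output string, cell -1 stays blank, and
   block b occupies the w cells to the left of -1 - b * w: one flag for each
   register whose value is b, and the b-th memory bit. *)
Definition layout (s : rstate) : Z -> option bool := fun z =>
  if Z.leb 0 z then onth (io s) (Z.to_nat z) else if Z.eqb z (-1) then None else
  let p := Z.to_nat (- 2 - z) in flag (bcell s (p %/ w) (p %% w)).

Lemma layout_io s i : layout s (Z.of_nat i) = onth (io s) i.
Proof. by rewrite /layout; case: Z.leb_spec; [rewrite Nat2Z.id|lia]. Qed.

Lemma layout_block s b j : j < w -> layout s (bpos b j) = flag (bcell s b j).
Proof.
move=> jw; rewrite /layout /bpos.
case: Z.leb_spec => [|_]; first by lia.
case: Z.eqb_spec => [|_]; first by lia.
have -> : Z.to_nat (-2 - (-2 - Z.of_nat (b * w + j))) = b * w + j by lia.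
by rewrite divnMDl // divn_small // addn0 modnMDl modn_small.
Qed.

Lemma bpos_inj b j b' j' : j < w -> j' < w -> bpos b j = bpos b' j' -> b = b' /\ j = j'.
Proof.
move=> jw jw' E; have {}E : b * w + j = b' * w + j' by rewrite /bpos in E; lia.
split.
  have := congr1 (divn^~ w) E.
  by rewrite /= !divnMDl // !divn_small // !addn0.
by have := congr1 (modn^~ w) E; rewrite /= !modnMDl !modn_small.
Qed.

Lemma layout_eq f s : (forall i, f (Z.of_nat i) = onth (io s) i) -> f (-1)%Z = None ->
  (forall b j, j < w -> f (bpos b j) = flag (bcell s b j)) -> f = layout s.
Proof.
move=> f0 f1 f2; apply: functional_extensionality => z.
rewrite /layout; case: Z.leb_spec => z0.
  by rewrite -f0; congr f; lia.
case: Z.eqb_spec => [->//|z1]; rewrite -f2 ?ltn_mod //; congr f.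
rewrite /bpos -divn_eq; lia.
Qed.

(** From cell -1, [j.+1] moves reach track [j] of block 0. Strides of one block then stop at the
    only flag on this track, in the block numbered by the value of the register. *)
Definition goto_reg (j : nat) : code :=
  CSeq (moves MoveL j.+1) (CWhile not_flag (moves MoveL w)).

Definition go_home (j : nat) : code :=
  CSeq (moves MoveR j) (CSeq (CWhile not_flag (moves MoveR w)) (moves MoveR 1)).

(** The benefit of the block layout: two registers are equal iff their flags share a block, and the
    bit addressed by a register lies in the block of its flag. Comparison and indirect addressing
    thus become a sideways move inside one block. *)
Definition shift_track (i j : nat) : code :=
  if i <= j then moves MoveL (j - i) else moves MoveR (i - j).

Lemma runs_shift f b i j : i < w -> j < w ->
  runs (shift_track i j) (f, bpos b i) (f, bpos b j) w.
Proof.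
move=> iw jw; rewrite /shift_track /bpos; case: leqP => ij;
  apply: runs_moves_to; rewrite /displacement; lia.
Qed.

Lemma runs_goto_reg f j b : j < m -> (forall b', f (bpos b' j) = flag (b' == b)) ->
  runs (goto_reg j) (f, (-1)%Z) (f, bpos b j) ((w + 2) * b.+1).
Proof.
move=> jm fE; have -> : (w + 2) * b.+1 = w + (2 + b * (w + 2)) by lia.
apply: (runs_seq (y := (f, bpos 0 j))).
  by apply: runs_moves_to; rewrite /displacement /bpos; lia.
have gen d b0 : b0 + d = b ->
  runs (CWhile not_flag (moves MoveL w)) (f, bpos b0 j) (f, bpos b j) (2 + d * (w + 2)).
  elim: d b0 => [|d IH] b0 e.
    have -> : b0 = b by lia.
    by apply: (runsW (T := 1)) => //; apply: runs_whileF; rewrite /not_flag /= fE eqxx.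
  apply: (@runsW _ _ _ (w + (2 + d * (w + 2))).+2); last by lia.
  apply: (runs_whileT (y := (f, bpos b0.+1 j))).
  - by rewrite /not_flag /= fE; have -> : b0 == b = false by lia.
  - by apply: runs_moves_to; rewrite /displacement /bpos; lia.
  - by apply: IH; lia.
by apply: gen.
Qed.

Lemma runs_go_home f j b : j < w -> 0 < m -> (forall b', f (bpos b' 0) = flag (b' == 0)) ->
  runs (go_home j) (f, bpos b j) (f, (-1)%Z) ((w + 2) * b.+1 + 1).
Proof.
move=> jm m0 fE; have -> : (w + 2) * b.+1 + 1 = w + ((2 + b * (w + 2)) + 1) by lia.
apply: (runs_seq (y := (f, bpos b 0))).
  by apply: runs_moves_to; rewrite /displacement /bpos; lia.
apply: (runs_seq (y := (f, bpos 0 0))); last by apply: runs_moves_to; rewrite /displacement /bpos; lia.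
elim: b => [|b IH].
  by apply: (runsW (T := 1)) => //; apply: runs_whileF; rewrite /not_flag /= fE eqxx.
apply: (@runsW _ _ _ (w + (2 + b * (w + 2))).+2); last by lia.
apply: (runs_whileT (y := (f, bpos b 0))) => //.
- by rewrite /not_flag /= fE.
- by apply: runs_moves_to; rewrite /displacement /bpos; lia.
Qed.

(** Translated code starts and ends with the head on cell -1. A loop test, however, is made on track
    [j] in the block of register [i], so the loop body first goes home and finally returns to that
    kind of cell. *)
Fixpoint rcode (c : rm) : code :=
  match c with
  | RSkip => CSkip
  | RInc j => CSeq (goto_reg j) (CSeq (CWrite None) (CSeq (moves MoveL w)
                (CSeq (CWrite (Some true)) (go_home j))))
  | RClr j => CSeq (goto_reg j) (CSeq (CWrite None) (CSeq (go_home j)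
                (CSeq (moves MoveL j.+1) (CSeq (CWrite (Some true)) (moves MoveR j.+1)))))
  | RSet j => CSeq (goto_reg j) (CSeq (shift_track j m)
                (CSeq (CWrite (Some true)) (go_home m)))
  | RPush b => CSeq (moves MoveR 1) (CSeq (walk MoveR)
                (CSeq (CWrite (Some b)) (walk MoveL)))
  | RSeq c1 c2 => CSeq (rcode c1) (rcode c2)
  | RIfEq i j c1 c2 => CSeq (goto_reg i) (CSeq (shift_track i j)
      (CIf is_flag (CSeq (go_home j) (rcode c1)) (CSeq (go_home j) (rcode c2))))
  | RIfBit j c1 c2 => CSeq (goto_reg j) (CSeq (shift_track j m)
      (CIf is_flag (CSeq (go_home m) (rcode c1)) (CSeq (go_home m) (rcode c2))))
  | RIfPop c0 c1 c2 => CSeq (moves MoveR 1) (CSeq (walk MoveR) (CSeq (moves MoveL 1)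
      (CIf nonblank
        (CIf is_flag
          (CSeq (CWrite None) (CSeq (moves MoveL 1) (CSeq (walk MoveL) (rcode c1))))
          (CSeq (CWrite None) (CSeq (moves MoveL 1) (CSeq (walk MoveL) (rcode c2)))))
        (rcode c0))))
  | RWhileNe i j c => CSeq (goto_reg i) (CSeq (shift_track i j) (CSeq
      (CWhile not_flag
        (CSeq (go_home j) (CSeq (rcode c) (CSeq (goto_reg i) (shift_track i j)))))
      (go_home j)))
  end.

Definition rbounded (N : nat) (s : rstate) : Prop :=
  (forall j, reg s j <= N) /\ size (io s) <= N.

(** An instruction raises a register or lengthens the string by at most one, so the running time
    also bounds the part of the tape that has to be crossed. *)
Lemma rexec_inv c s s' T : rexec c s s' T -> rwf m c ->
  (reg s 0 = 0 -> reg s' 0 = 0) /\ (forall N, rbounded N s -> rbounded (N + T) s').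
Proof.
elim => {c s s' T}.
- by move=> s _; split=> // N; rewrite addn0.
- move=> j s /= /andP[j0 _]; split; first by rewrite /fset; case: eqP j0 => // <-.
  move=> N [b1 b2]; split=> /=; last by lia.
  by move=> i; rewrite /fset; case: eqP => [_|_]; [have := b1 j|have := b1 i]; lia.
- move=> j s /= /andP[j0 _]; split; first by rewrite /fset; case: eqP j0 => // <-.
  move=> N [b1 b2]; split=> /=; last by lia.
  by move=> i; rewrite /fset; case: eqP => [_|_]; [have := b1 j|have := b1 i]; lia.
- move=> j s _; split => // N [b1 b2]; split=> /=; last by lia.
  by move=> i; have := b1 i; lia.
- move=> b s _; split => // N [b1 b2]; split=> /=; last by rewrite size_rcons; lia.
  by move=> i; have := b1 i; lia.
- move=> c1 c2 s1 s2 s3 t1 t2 _ IH1 _ IH2 /= /andP[/IH1[a1 b1] /IH2[a2 b2]].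
  by split=> [/a1|N /b1/b2]; rewrite ?addnA.
- move=> i j c1 c2 s s' t _ IH /= /and4P[_ _ w1 w2].
  have [|a b] := IH; first by case: ifP.
  split=> // N bN; have := b N.+1; rewrite addSnnS; apply.
  by case: bN => b1 b2; split=> [k|]; [have := b1 k|]; lia.
- move=> j c1 c2 s s' t _ IH /= /and3P[_ w1 w2].
  have [|a b] := IH; first by case: ifP.
  split=> // N bN; have := b N.+1; rewrite addSnnS; apply.
  by case: bN => b1 b2; split=> [k|]; [have := b1 k|]; lia.
- move=> c0 c1 c2 s s' t _ _ IH /= /and3P[w0 w1 w2].
  have [|a b] := IH; first by [].
  split=> // N bN; have := b N.+1; rewrite addSnnS; apply.
  by case: bN => b1 b2; split=> [k|]; [have := b1 k|]; lia.
- move=> c0 c1 c2 s s' t l bb E _ IH /= /and3P[w0 w1 w2].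
  have [|a b] := IH; first by case: ifP.
  split=> // N bN; have := b N.+1; rewrite addSnnS; apply.
  case: bN => b1; rewrite E size_rcons => b2.
  by split=> [k|] /=; [have := b1 k|]; lia.
- move=> i j c s1 s2 s3 t1 t2 _ _ IH1 _ IH2 wf.
  have [a2 b2] := IH2 wf; case/and3P: wf => _ _ /IH1[a1 b1].
  split=> [/a1/a2//|N bN]; have := b2 _ (b1 N bN).
  case=> x y; split=> [k|]; [have := x k|]; lia.
- move=> i j c s _ _; split=> // N [b1 b2].
  by split=> [k|]; [have := b1 k|]; lia.
Qed.

End Layout.

(** * Simulation of register instructions on the block layout *)

Section Simulation.

Variable m : nat.
Hypothesis m_gt0 : 0 < m.
Let w := m.+1.

Lemma tput_bpos f b j o b' j' : j < w -> j' < w ->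
  tput f (bpos m b j) o (bpos m b' j') =
  if (b' == b) && (j' == j) then o else f (bpos m b' j').
Proof.
move=> jw jw'; case: andP => [[/eqP-> /eqP->]|N]; first exact: tput_eq.
by apply: tput_ne => /bpos_inj[] // E1 E2; apply: N; rewrite E1 E2 !eqxx.
Qed.

Lemma tput_bpos_ge0 f b j o z : (-1 <= z)%Z -> tput f (bpos m b j) o z = f z.
Proof. by move=> z0; apply: tput_ne; rewrite /bpos; lia. Qed.

Lemma layout_inc s j : j < m ->
  tput (tput (layout m s) (bpos m (reg s j) j) None) (bpos m (reg s j).+1 j) (Some true)
  = layout m (set_reg s j (reg s j).+1).
Proof.
move=> jm; have jw : j < w by rewrite /w; lia.
apply: layout_eq => [i||b j' jw'].
- by rewrite !tput_bpos_ge0 ?layout_io //; lia.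
- by rewrite !tput_bpos_ge0.
- rewrite !tput_bpos // layout_block // /bcell /= /fset.
  case: (j' =P j) => [->|_]; rewrite ?andbF // !andbT (ltn_eqF jm).
  rewrite [b == _]eq_sym; case: eqP => // _.
  by rewrite eq_sym; case: eqP.
Qed.

Lemma layout_clr s j : j < m ->
  tput (tput (layout m s) (bpos m (reg s j) j) None) (bpos m 0 j) (Some true)
  = layout m (set_reg s j 0).
Proof.
move=> jm; have jw : j < w by rewrite /w; lia.
apply: layout_eq => [i||b j' jw'].
- by rewrite !tput_bpos_ge0 ?layout_io //; lia.
- by rewrite !tput_bpos_ge0.
- rewrite !tput_bpos // layout_block // /bcell /= /fset.
  case: (j' =P j) => [->|_]; rewrite ?andbF // !andbT (ltn_eqF jm).
  rewrite [b == 0]eq_sym; case: eqP => // _.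
  by rewrite eq_sym; case: eqP.
Qed.

Lemma layout_set s p : tput (layout m s) (bpos m p m) (Some true) = layout m (set_mem s p true).
Proof.
have mw : m < w by [].
apply: layout_eq => [i||b j' jw'].
- by rewrite !tput_bpos_ge0 ?layout_io //; lia.
- by rewrite !tput_bpos_ge0.
- rewrite !tput_bpos // layout_block // /bcell /= /fset.
  by case: (j' =P m); rewrite ?andbF ?andbT //; case: (b =P p).
Qed.

Lemma layout_set_io s l i o :
  (forall k, (if k == i then o else onth (io s) k) = onth l k) ->
  tput (layout m s) (Z.of_nat i) o = layout m (set_io s l).
Proof.
move=> E; apply: layout_eq => [k||b j jw].
- rewrite -E; case: eqP => [->|N]; first exact: tput_eq.
  by rewrite tput_ne ?layout_io //; lia.
- by rewrite tput_ne //; lia.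
- by rewrite tput_ne ?layout_block // /bpos; lia.
Qed.

Lemma io_nonblank s i : (layout m s (Z.of_nat i) != None) = (i < size (io s)).
Proof. by rewrite layout_io -onthTE; case: onth. Qed.

Lemma runs_goto_layout s j B : j < m -> rbounded B s ->
  runs (goto_reg m j) (layout m s, (-1)%Z) (layout m s, bpos m (reg s j) j) ((w + 2) * B.+1).
Proof.
move=> jm [b1 _].
apply: runsW (runs_goto_reg jm (b := reg s j) _) _; last by rewrite leq_mul2l ltnS b1 orbT.
move=> b; rewrite layout_block; last by apply: ltnW.
by rewrite /bcell (ltn_eqF jm) eq_sym.
Qed.

Lemma runs_home_layout s j b B : j < w -> reg s 0 = 0 -> b <= B ->
  runs (go_home m j) (layout m s, bpos m b j) (layout m s, (-1)%Z) ((w + 2) * B.+1 + 1).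
Proof.
move=> jw r0 bB.
apply: runsW (runs_go_home b jw m_gt0 _) _.
  move=> b'; rewrite layout_block //.
  by rewrite /bcell ltn_eqF // r0 eq_sym.
by rewrite leq_add2r leq_mul2l ltnS bB orbT.
Qed.

Lemma runs_push s b :
  runs (rcode m (RPush b)) (layout m s, (-1)%Z)
    (layout m (set_io s (rcons (io s) b)), (-1)%Z) (6 * size (io s) + 7).
Proof.
set n := size (io s).
have -> : 6 * n + 7 = 1 + ((3 * n + 1) + (1 + (3 * n.+1 + 1))) by lia.
apply: (runs_seq (y := (layout m s, 0%Z))); first by apply: runs_moves_to.
apply: runs_seq; first by apply: runs_walkR => i; exact: io_nonblank.
apply: runs_seq; first exact: runs_write.
rewrite (@layout_set_io s (rcons (io s) b)); last first.
  move=> k; rewrite -cats1 onth_cat -/n.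
  case: ltngtP => [h|h|->] //; last by rewrite subnn.
  by rewrite !onth_default //=; [rewrite -/n|]; lia.
have -> : Z.of_nat n = (Z.of_nat n.+1 - 1)%Z by lia.
apply: runs_walkL => [i lt|//].
by rewrite io_nonblank /= size_rcons.
Qed.

Lemma runs_pop0 s c0 c1 c2 y T : io s = [::] ->
  runs (rcode m c0) (layout m s, (-1)%Z) y T ->
  runs (rcode m (RIfPop c0 c1 c2)) (layout m s, (-1)%Z) y (T + 5).
Proof.
move=> E H; rewrite addnC -[5]/(1 + (1 + (1 + 2))) -!addnA.
apply: (runs_seq (y := (layout m s, 0%Z))); first by apply: runs_moves_to.
apply: runs_seq.
  by apply: (@runs_walkR _ 0) => i; rewrite io_nonblank E.
apply: (runs_seq (y := (layout m s, (-1)%Z))); first by apply: runs_moves_to.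
by apply: runs_if.
Qed.

Lemma runs_pop s c0 c1 c2 y T l b : io s = rcons l b ->
  runs (rcode m (if b then c1 else c2)) (layout m (set_io s l), (-1)%Z) y T ->
  runs (rcode m (RIfPop c0 c1 c2)) (layout m s, (-1)%Z) y (T + (6 * size (io s) + 9)).
Proof.
move=> E H; set n := size l.
have sn : size (io s) = n.+1 by rewrite E size_rcons.
apply: (@runsW _ _ _ (1 + ((3 * n.+1 + 1) + (1 + (1 + (1 + (3 * n + 1 + T))).+4))));
  last by rewrite sn; lia.
apply: (runs_seq (y := (layout m s, 0%Z))); first by apply: runs_moves_to.
apply: runs_seq; first by apply: runs_walkR => i; rewrite io_nonblank sn.
apply: (runs_seq (y := (layout m s, Z.of_nat n))).
  by apply: runs_moves_to; rewrite /displacement; lia.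
have on : layout m s (Z.of_nat n) = Some b.
  by rewrite layout_io E -cats1 onth_cat ltnn subnn.
apply: runs_if; rewrite /fst /snd on.
apply: runs_if; rewrite /fst /snd on.
have ->: is_flag (Some b) = b by case: (b).
rewrite -(fun_if (fun c => CSeq (CWrite None) (CSeq (moves MoveL 1)
   (CSeq (walk MoveL) (rcode m c))))).
apply: runs_seq; first exact: runs_write.
rewrite (@layout_set_io s l); last first.
  move=> k; rewrite E -cats1 onth_cat -/n.
  case: ltngtP => [h|h|->] //.
    by rewrite !onth_default //=; lia.
  by rewrite onth_default.
apply: (runs_seq (y := (layout m (set_io s l), (Z.of_nat n - 1)%Z))).
  by apply: runs_moves_to.
apply: (runs_seq (y := (layout m (set_io s l), (-1)%Z))); last by [].
by apply: runs_walkL => [i lt|//]; rewrite io_nonblank.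
Qed.

Lemma is_flagE b : is_flag (flag b) = b.
Proof. by case: b. Qed.

Lemma bcell_reg s i j : j < m -> bcell m s (reg s i) j = (reg s i == reg s j).
Proof. by move=> jm; rewrite /bcell (ltn_eqF jm) eq_sym. Qed.

(** A generous price for one register instruction: a fixed number of passes over about [B] blocks or
    string cells. *)
Definition step_bound (B : nat) : nat := 10 * (w + 2) * B.+2.

Definition while_body (i j : nat) (c : rm) : code :=
  CSeq (go_home m j) (CSeq (rcode m c) (CSeq (goto_reg m i) (shift_track i j))).

(** The second conjunct is what the induction needs for loops: the rest of a loop is entered at its
    test, not from cell -1 as in the first conjunct. Its [T.-1] leaves one [step_bound] for reaching
    the first test and for going home at the end. *)
Lemma rcode_simulates c s s' T : rexec c s s' T -> rwf m c -> reg s 0 = 0 ->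
  forall N B, rbounded N s -> N + T <= B ->
  runs (rcode m c) (layout m s, (-1)%Z) (layout m s', (-1)%Z) (T * step_bound B) /\
  (forall i j c', c = RWhileNe i j c' ->
    runs (CWhile not_flag (while_body i j c'))
      (layout m s, bpos m (reg s i) j) (layout m s', bpos m (reg s' i) j)
      (T.-1 * step_bound B + 1)).
Proof.
have bW N B s0 : rbounded N s0 -> N <= B -> rbounded B s0.
  by move=> [b1 b2] NB; split=> [k|]; [have := b1 k|]; lia.
have mw j : j < m -> j < w by rewrite /w; lia.
have U B : 30 * B.+2 <= step_bound B.
  by rewrite /step_bound leq_mul2r /w; apply/orP; right; lia.
elim => {c s s' T}.
- move=> s _ _ N B _ _; split=> //; exists 0 => //; constructor.
- move=> j s /andP[j0 jm] r0 N B bN NB; split=> //.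
  have bB : rbounded B s by apply: bW bN _; lia.
  have rB : reg s j < B by case: bN => b1 _; have := b1 j; lia.
  apply: (@runsW _ _ _ ((w + 2) * B.+1 + (1 + (w + (1 + ((w + 2) * B.+1 + 1))))));
    last by rewrite /step_bound; nia.
  apply: runs_seq; first exact: runs_goto_layout.
  apply: runs_seq; first exact: runs_write.
  apply: (runs_seq (y := (_, bpos m (reg s j).+1 j))).
    by apply: runs_moves_to; rewrite /displacement /bpos; lia.
  apply: runs_seq; first exact: runs_write.
  rewrite layout_inc //; apply: runs_home_layout; rewrite ?mw //.
  by rewrite /= /fset; case: eqP j0 => // <-.
- move=> j s /andP[j0 jm] r0 N B bN NB; split=> //.
  have bB : rbounded B s by apply: bW bN _; lia.
  have rB : reg s j < B by case: bN => b1 _; have := b1 j; lia.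
  apply: (@runsW _ _ _ ((w + 2) * B.+1 + (1 + (((w + 2) * (reg s j).+1 + 1) + (w + (1 + w))))));
    last by rewrite /step_bound; nia.
  apply: runs_seq; first exact: runs_goto_layout.
  apply: runs_seq; first exact: runs_write.
  apply: runs_seq.
    apply: runs_go_home; rewrite ?mw // => b.
    rewrite tput_bpos ?mw // (ltn_eqF j0) andbF.
    by rewrite layout_block // /bcell (ltn_eqF m_gt0) r0 eq_sym.
  apply: (runs_seq (y := (_, bpos m 0 j))).
    by apply: runs_moves_to; rewrite /displacement /bpos ?mw //; lia.
  apply: runs_seq; first exact: runs_write.
  rewrite layout_clr //.
  by apply: runs_moves_to; rewrite /displacement /bpos ?mw //; lia.
- move=> j s /= jm r0 N B bN NB; split=> //.
  have bB : rbounded B s by apply: bW bN _; lia.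
  have rB : reg s j < B by case: bN => b1 _; have := b1 j; lia.
  apply: (@runsW _ _ _ ((w + 2) * B.+1 + (w + (1 + ((w + 2) * B.+1 + 1)))));
    last by rewrite /step_bound; nia.
  apply: runs_seq; first exact: runs_goto_layout.
  apply: runs_seq; first by apply: runs_shift => //; exact: mw.
  apply: runs_seq; first exact: runs_write.
  by rewrite layout_set; apply: runs_home_layout => //; lia.
- move=> b s _ r0 N B bN NB; split=> //.
  apply: runsW (runs_push s b) _.
  by case: bN => _ b2; rewrite /step_bound; nia.
- move=> c1 c2 s1 s2 s3 t1 t2 e1 IH1 _ IH2 /= /andP[w1 w2] r0 N B bN NB; split=> //.
  have [z1 z2] := rexec_inv e1 w1.
  rewrite mulnDl; apply: (runs_seq (y := (layout m s2, (-1)%Z))).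
    by have [||] := IH1 w1 r0 N B => //; lia.
  by have [|] := IH2 w2 (z1 r0) (N + t1) B (z2 _ bN) => //; lia.
- move=> i j c1 c2 s s' t _ IH /= /and4P[im jm w1 w2] r0 N B bN NB; split=> //.
  have bB : rbounded B s by apply: bW bN _; lia.
  have rB : reg s i < B by case: bN => b1 _; have := b1 i; lia.
  apply: (@runsW _ _ _ ((w + 2) * B.+1 + (w + (((w + 2) * B.+1 + 1) + t * step_bound B).+2)));
    last by rewrite mulSn addnC; move: (t * _) => ?; rewrite /step_bound; nia.
  apply: runs_seq; first exact: runs_goto_layout.
  apply: runs_seq; first by apply: runs_shift => //; exact: mw.
  apply: runs_if; rewrite /fst /snd layout_block ?mw // is_flagE bcell_reg //.
  rewrite -(fun_if (fun c => CSeq (go_home m j) (rcode m c))).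
  apply: runs_seq; first by apply: runs_home_layout (mw _ jm) _ (ltnW rB).
  have [||] // := IH _ r0 N B bN; last by lia.
  by case: ifP.
- move=> j c1 c2 s s' t _ IH /= /and3P[jm w1 w2] r0 N B bN NB; split=> //.
  have bB : rbounded B s by apply: bW bN _; lia.
  have rB : reg s j < B by case: bN => b1 _; have := b1 j; lia.
  apply: (@runsW _ _ _ ((w + 2) * B.+1 + (w + (((w + 2) * B.+1 + 1) + t * step_bound B).+2)));
    last by rewrite mulSn addnC; move: (t * _) => ?; rewrite /step_bound; nia.
  apply: runs_seq; first exact: runs_goto_layout.
  apply: runs_seq; first by apply: runs_shift => //; exact: mw.
  apply: runs_if; rewrite /fst /snd layout_block // is_flagE /bcell eqxx.
  rewrite -(fun_if (fun c => CSeq (go_home m m) (rcode m c))).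
  apply: runs_seq; first by apply: runs_home_layout (ltnSn m) _ (ltnW rB).
  have [||] // := IH _ r0 N B bN; last by lia.
  by case: ifP.
- move=> c0 c1 c2 s s' t E _ IH /= /and3P[w0 w1 w2] r0 N B bN NB; split=> //.
  apply: (runsW (runs_pop0 _ _ E (T := t * step_bound B) _)).
    by have [|] := IH w0 r0 N B bN => //; lia.
  by rewrite mulSn; move: (t * _) => ?; rewrite /step_bound; nia.
- move=> c0 c1 c2 s s' t l b E _ IH /= /and3P[w0 w1 w2] r0 N B bN NB; split=> //.
  apply: (runsW (runs_pop _ E (T := t * step_bound B) _)).
    have bN' : rbounded N (set_io s l).
      by case: bN => b1; rewrite E size_rcons => b2; split=> //=; lia.
    have [||] // := IH _ r0 N B bN'; last by lia.
    by case: ifP.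
  by case: bN => _ b2; have := U B; rewrite mulSn; lia.
- move=> i j c s1 s2 s3 t1 t2 ne e1 IH1 e2 IH2 wf r0 N B bN NB.
  have bB : rbounded B s1 by apply: bW bN _; lia.
  (* The rest of the loop takes at least its exit test; the [step_bound] left over by [t2.-1] pays
     for the travel around the body. *)
  have t2_gt0 : 0 < t2 by inversion e2.
  have /and3P[im jm wc] := wf.
  have [z1 z2] := rexec_inv e1 wc.
  have [] := IH2 wf (z1 r0) (N + t1) B (z2 _ bN); first by lia.
  move=> _ /(_ i j c erefl) loop.
  have [] := IH1 wc r0 N B bN; first by lia.
  move=> body _.
  have b2B : rbounded B s2 by apply: bW (z2 _ bN) _; lia.
  have rB : reg s1 i <= B by case: bB.
  have all_loop : runs (CWhile not_flag (while_body i j c))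
      (layout m s1, bpos m (reg s1 i) j) (layout m s3, bpos m (reg s3 i) j)
      ((t1 + t2) * step_bound B + 1).
    apply: runsW (runs_whileT (y := (layout m s2, bpos m (reg s2 i) j)) _ _ loop) _.
    + rewrite /fst /snd /not_flag layout_block ?mw // bcell_reg // (negbTE ne) //.
    + apply: runs_seq; first by apply: runs_home_layout => //; exact: mw.
      apply: runs_seq; first exact: body.
      apply: runs_seq; first by apply: runs_goto_layout b2B.
      by apply: runs_shift; exact: mw.
    + rewrite (mulnDl t1); have -> : t2 * step_bound B = step_bound B + t2.-1 * step_bound B.
        by rewrite -mulSn prednK.
      by move: (t1 * _) (t2.-1 * _) => ??; rewrite /step_bound; nia.
  have b3B : reg s3 i <= B.
    have [_ q] := rexec_inv e2 wf; have [q1 _] := q _ (z2 _ bN).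
    by have := q1 i; lia.
  have r3 : reg s3 0 = 0.
    by have [q _] := rexec_inv e2 wf; apply: q; exact: z1.
  split; last by move=> i' j' c' [<- <- <-].
  apply: (@runsW _ _ _ ((w + 2) * B.+1 + (w + (((t1 + t2) * step_bound B + 1) + ((w + 2) * B.+1 + 1)))));
    last by rewrite mulSn addnC; move: (_ * step_bound B) => ?; rewrite /step_bound; nia.
  apply: runs_seq; first by apply: runs_goto_layout.
  apply: runs_seq; first by apply: runs_shift => //; exact: mw.
  apply: runs_seq; first exact: all_loop.
  by apply: runs_home_layout => //; exact: mw.
- move=> i j c s e /= /and3P[im jm wc] r0 N B bN NB.
  have bB : rbounded B s by apply: bW bN _; lia.
  have rB : reg s i <= B by case: bB.
  have loop : runs (CWhile not_flag (while_body i j c))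
      (layout m s, bpos m (reg s i) j) (layout m s, bpos m (reg s i) j) 1.
    apply: runs_whileF.
    by rewrite /fst /snd /not_flag layout_block ?mw // bcell_reg // e eqxx.
  split; last by move=> i' j' c' [<- <- <-].
  apply: (@runsW _ _ _ ((w + 2) * B.+1 + (w + (1 + ((w + 2) * B.+1 + 1)))));
    last by rewrite /step_bound; nia.
  apply: runs_seq; first by apply: runs_goto_layout.
  apply: runs_seq; first by apply: runs_shift => //; exact: mw.
  apply: runs_seq; first exact: loop.
  by apply: runs_home_layout => //; exact: mw.
Qed.

End Simulation.

(** * Choice of the block width and preparation of the tape *)

Fixpoint rsafe (c : rm) : bool :=
  match c with
  | RSkip | RPush _ | RSet _ => true
  | RInc j | RClr j => 0 < j
  | RSeq c1 c2 | RIfEq _ _ c1 c2 | RIfBit _ c1 c2 => rsafe c1 && rsafe c2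
  | RIfPop c0 c1 c2 => [&& rsafe c0, rsafe c1 & rsafe c2]
  | RWhileNe _ _ c => rsafe c
  end.

Lemma rwf_mono c m m' : m <= m' -> rwf m c -> rwf m' c.
Proof.
move=> le; elim: c => //=.
- by move=> j; lia.
- by move=> j; lia.
- by move=> j; lia.
- by move=> c1 IH1 c2 IH2 /andP[/IH1-> /IH2->].
- by move=> i j c1 IH1 c2 IH2 /and4P[a b /IH1-> /IH2->]; rewrite !andbT; lia.
- by move=> j c1 IH1 c2 IH2 /and3P[b /IH1-> /IH2->]; rewrite !andbT; lia.
- by move=> c1 IH1 c2 IH2 c3 IH3 /and3P[/IH1-> /IH2-> /IH3->].
- by move=> i j c IH /and3P[a b /IH->]; rewrite !andbT; lia.
Qed.

(** Code mentions finitely many registers, so some width exceeds them all; [rsafe] keeps the one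
    condition that does not depend on the width. *)
Lemma rsafe_rwf c : rsafe c -> exists2 m, 0 < m & rwf m c.
Proof.
have join m1 m2 c1 c2 : rwf m1 c1 -> rwf m2 c2 ->
    rwf (m1 + m2) c1 /\ rwf (m1 + m2) c2.
  by split; [apply: rwf_mono H; lia|apply: rwf_mono H0; lia].
elim: c => /=.
- by exists 1.
- by move=> j j0; exists j.+1 => //; rewrite j0 /=.
- by move=> j j0; exists j.+1 => //; rewrite j0 /=.
- by move=> j _; exists j.+1.
- by exists 1.
- move=> c1 IH1 c2 IH2 /andP[/IH1[m1 p1 w1] /IH2[m2 p2 w2]].
  have [a b] := join _ _ _ _ w1 w2.
  by exists (m1 + m2); [lia|rewrite a b].
- move=> i j c1 IH1 c2 IH2 /andP[/IH1[m1 p1 w1] /IH2[m2 p2 w2]].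
  have [a b] := join _ _ _ _ w1 w2.
  exists (m1 + m2 + i + j); first lia.
  by rewrite !(rwf_mono _ a) ?(rwf_mono _ b) ?andbT //; lia.
- move=> j c1 IH1 c2 IH2 /andP[/IH1[m1 p1 w1] /IH2[m2 p2 w2]].
  have [a b] := join _ _ _ _ w1 w2.
  exists (m1 + m2 + j); first lia.
  by rewrite !(rwf_mono _ a) ?(rwf_mono _ b) ?andbT //; lia.
- move=> c1 IH1 c2 IH2 c3 IH3 /and3P[/IH1[m1 p1 w1] /IH2[m2 p2 w2] /IH3[m3 p3 w3]].
  exists (m1 + m2 + m3); first lia.
  by apply/and3P; split; [apply: rwf_mono w1|apply: rwf_mono w2|apply: rwf_mono w3]; lia.
- move=> i j c IH /IH[m p w]; exists (m + i + j); first lia.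
  by rewrite (rwf_mono _ w) ?andbT; lia.
Qed.

Definition rinit (x : seq bool) : rstate := RState (fun=> 0) (fun=> false) x.

(** All registers start at 0, so the initial layout consists of the input and the register flags of
    block 0. *)
Fixpoint write_flags (n : nat) : code :=
  if n is n'.+1 then CSeq (CMove MoveL) (CSeq (CWrite (Some true)) (write_flags n'))
  else CSkip.

Lemma runs_write_flags n f h :
  runs (write_flags n) (f, h)
    ((fun z => if Z.leb (h - Z.of_nat n) z && Z.ltb z h then Some true else f z),
     (h - Z.of_nat n)%Z) (2 * n).
Proof.
elim: n f h => [|n IH] f h /=.
  exists 0 => //; rewrite Z.sub_0_r.
  have -> : (fun z => if Z.leb h z && Z.ltb z h then Some true else f z) = f.
    apply: functional_extensionality => z.
    by case: Z.leb_spec; case: Z.ltb_spec => //; lia.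
  exact: XSkip.
have -> : 2 * n.+1 = 1 + (1 + 2 * n) by lia.
apply: runs_seq; first by exists 1 => //; exact: XMove.
apply: runs_seq; first exact: runs_write.
have := IH (tput f (h - 1) (Some true)) (h - 1)%Z.
have -> : (h - 1 - Z.of_nat n = h - Z.of_nat n.+1)%Z by lia.
set f1 := (fun z => _) => H; set f2 := (fun z => _).
suff -> : f2 = f1 by [].
apply: functional_extensionality => z; rewrite /f1 /f2 /tput /=.
by case: Z.leb_spec; case: Z.ltb_spec; case: Z.ltb_spec; case: Z.eqb_spec => //=; lia.
Qed.

Definition rprogram (m : nat) (c : rm) : code :=
  CSeq (moves MoveL 1) (CSeq (write_flags m) (CSeq (moves MoveR m)
    (CSeq (rcode m c) (CMove MoveR)))).

Lemma rprogram_size m c : 0 < csize (rprogram m c).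
Proof. by rewrite /=; lia. Qed.

Lemma layout_rinit m x :
  (fun z => if Z.leb (-1 - Z.of_nat m) z && Z.ltb z (-1) then Some true
            else (init_tape x).1 z) = layout m (rinit x).
Proof.
apply: layout_eq => [i||b j jm].
- rewrite /=; case: Z.ltb_spec; first lia; case: Z.ltb_spec; first lia.
  by rewrite andbF Nat2Z.id.
- by rewrite Z.ltb_irrefl andbF.
- rewrite /bcell /bpos -[reg _ _]/0 -[ram _ _]/false /init_tape /fst.
  case: Z.ltb_spec => [_|]; last lia.
  case: Z.ltb_spec => [_|]; last lia.
  rewrite andbT; case: b => [|b]; 
    [rewrite mul0n | rewrite mulSn; move: (b * _) => ?];
    by case: (j =P m) => ?; case: Z.leb_spec => ? //; lia.
Qed.

Theorem rm_machine (c : rm) : rsafe c -> exists M K, forall x s' T,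
  rexec c (rinit x) s' T ->
  tm_computes_within M x (K * (size x + T).+1 ^ 2) (io s').
Proof.
move=> /rsafe_rwf[m m0 wf].
(* The summand [3 * m + 2] pays for the set-up and the final move, the other for [T] instructions at
   [step_bound m B] each, as [B.+2] is at most twice [B.+1]. *)
exists (machine_of (flatten_code (rprogram m c) 0)), (3 * m + 2 + 20 * (m + 3)).
move=> x s' T ex; set B := size x + T.
have b0 : rbounded (size x) (rinit x) by [].
have [sim _] := rcode_simulates m0 ex wf erefl b0 (leqnn B).
have [t tle ext] : runs (rprogram m c) (init_tape x) (layout m s', 0%Z)
    (1 + (2 * m + (m + (T * step_bound m B + 1)))).
  apply: (runs_seq (y := ((init_tape x).1, (-1)%Z))); first by apply: runs_moves_to.
  apply: runs_seq; first exact: runs_write_flags.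
  rewrite layout_rinit.
  apply: (runs_seq (y := (layout m (rinit x), (-1)%Z))).
    by apply: runs_moves_to; rewrite /displacement; lia.
  apply: runs_seq; first exact: sim.
  by exists 1 => //; exact: XMove.
have [||t' t'le [h1 h2]] := code_computes _ ext (y := io s').
- exact: rprogram_size.
- by move=> i; rewrite -(layout_io m); congr (layout _ _ _); lia.
exists t' => //; apply: leq_trans t'le (leq_trans tle _).
have TB : T <= B by rewrite /B; lia.
have : T * step_bound m B <= 20 * (m + 3) * B.+1 ^ 2.
  have -> : 20 * (m + 3) * B.+1 ^ 2 = B.+1 * (20 * (m + 3) * B.+1) by rewrite expnS expn1; nia.
  apply: leq_mul; first lia.
  by rewrite /step_bound; nia.
have : 0 < B.+1 ^ 2 by rewrite expn_gt0.
move: (B.+1 ^ 2) (T * _) => q r; nia.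
Qed.

(** * A loop language *)

Lemma leq_expW m n e : m <= n -> m ^ e <= n ^ e.
Proof. by case: e => // e le; rewrite leq_exp2r. Qed.

(** A base of at least 2 lets one exponent absorb coefficients and constants. The bound is monotone
    even if [f] is not, which gives closure under composition. *)
Definition polyb (f : nat -> nat) : Prop := exists K, forall B, f B <= (B + 2) ^ K.

Lemma polyb_const n : polyb (fun=> n).
Proof.
exists n => B; apply: leq_trans (ltnW (ltn_expl n (ltnSn 1))) _.
by apply: leq_expW; lia.
Qed.

Lemma polyb_id : polyb id.
Proof. by exists 1 => B; rewrite expn1; lia. Qed.

Lemma polyb_add f g : polyb f -> polyb g -> polyb (fun B => f B + g B).
Proof.
move=> [K fK] [L gL]; exists (K + L).+1 => B.
apply: leq_trans (leq_add (fK B) (gL B)) _; rewrite expnS expnD.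
have : 0 < (B + 2) ^ K by rewrite expn_gt0; lia.
have : 0 < (B + 2) ^ L by rewrite expn_gt0; lia.
move: (_ ^ K) (_ ^ L) => x y; nia.
Qed.

Lemma polyb_mul f g : polyb f -> polyb g -> polyb (fun B => f B * g B).
Proof.
by move=> [K fK] [L gL]; exists (K + L) => B; rewrite expnD; apply: leq_mul.
Qed.

Lemma polyb_comp f g : polyb f -> polyb g -> polyb (fun B => f (g B)).
Proof.
move=> [K fK] pg; have [L gL] := polyb_add pg (polyb_const 2).
exists (L * K) => B; apply: leq_trans (fK _) _.
by rewrite expnM; apply: leq_expW.
Qed.

Ltac solve_polyb :=
  repeat first [ exact: polyb_const | exact: polyb_id | eassumption
               | apply: polyb_add | apply: polyb_mul | apply: polyb_comp ].

Definition halts_in (c : rm) (s : rstate) (T : nat) (P : rstate -> Prop) : Prop :=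
  exists s' t, [/\ t <= T, rexec c s s' t & P s'].

Lemma halts_weaken c s T T' (P Q : rstate -> Prop) :
  halts_in c s T P -> T <= T' -> (forall s', P s' -> Q s') -> halts_in c s T' Q.
Proof.
move=> [s' [t [le e p]]] le' PQ; exists s', t; split=> //; last exact: PQ.
exact: leq_trans le'.
Qed.

Lemma halts_seq c1 c2 s T1 T2 (P Q : rstate -> Prop) :
  halts_in c1 s T1 P -> (forall s', P s' -> halts_in c2 s' T2 Q) ->
  halts_in (RSeq c1 c2) s (T1 + T2) Q.
Proof.
move=> [s1 [t1 [le1 e1 p1]]] H; have [s2 [t2 [le2 e2 p2]]] := H _ p1.
by exists s2, (t1 + t2); split=> //; [exact: leq_add|exact: ESeq e1 e2].
Qed.

Lemma halts_inc j s (P : rstate -> Prop) :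
  P (set_reg s j (reg s j).+1) -> halts_in (RInc j) s 1 P.
Proof. by move=> p; exists (set_reg s j (reg s j).+1), 1; split=> //; constructor. Qed.

Lemma halts_clr j s (P : rstate -> Prop) : P (set_reg s j 0) -> halts_in (RClr j) s 1 P.
Proof. by move=> p; exists (set_reg s j 0), 1; split=> //; constructor. Qed.

Lemma halts_skip s T (P : rstate -> Prop) : P s -> halts_in RSkip s T P.
Proof. by move=> p; exists s, 0; split=> //; constructor. Qed.

Lemma halts_ifeq i j c1 c2 s T P :
  halts_in (if reg s i == reg s j then c1 else c2) s T P ->
  halts_in (RIfEq i j c1 c2) s T.+1 P.
Proof. by move=> [s' [t [le e p]]]; exists s', t.+1; split=> //; constructor. Qed.

Lemma halts_ifbit j c1 c2 s T P :
  halts_in (if ram s (reg s j) then c1 else c2) s T P ->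
  halts_in (RIfBit j c1 c2) s T.+1 P.
Proof. by move=> [s' [t [le e p]]]; exists s', t.+1; split=> //; constructor. Qed.

Definition rfor (i j : nat) (c : rm) : rm :=
  RSeq (RClr i) (RWhileNe i j (RSeq c (RInc i))).

(** Counter and bound are ordinary registers: the invariant has to fix the bound, and the body has
    to leave the counter at its value. *)
Lemma halts_for (Inv : nat -> rstate -> Prop) i j n c s T :
  (forall k s', Inv k s' -> reg s' j = n) ->
  Inv 0 (set_reg s i 0) ->
  (forall k s', k < n -> Inv k s' -> reg s' i = k ->
    halts_in c s' T (fun s2 => reg s2 i = k /\ Inv k.+1 (set_reg s2 i k.+1))) ->
  halts_in (rfor i j c) s (n * T.+2 + 2) (fun s' => Inv n s' /\ reg s' i = n).
Proof.
move=> jn i0 step; have -> : n * T.+2 + 2 = 1 + (n * T.+2 + 1) by lia.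
apply: (halts_seq (P := fun s' => Inv 0 s' /\ reg s' i = 0)).
  by apply: halts_clr; split=> //; rewrite /= /fset eqxx.
have gen d k : k + d = n -> forall s', Inv k s' /\ reg s' i = k ->
   halts_in (RWhileNe i j (RSeq c (RInc i))) s' (d * T.+2 + 1)
     (fun s' => Inv n s' /\ reg s' i = n).
  elim: d k => [|d IH] k e s' [iv ri].
    have kn : k = n by lia.
    exists s', 1; split=> //; last by rewrite -kn.
    by constructor; rewrite ri (jn _ _ iv).
  have kn : k < n by lia.
  have [s2 [t [le ex [r2 i2]]]] := step k s' kn iv ri.
  have [||s3 [t3 [le3 e3 p3]]] := IH k.+1 _ (set_reg s2 i k.+1).
  - by lia.
  - by split=> //=; rewrite /fset eqxx.
  exists s3, ((t + 1) + t3).+1; split=> //; first by lia.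
  apply: EWhileT e3; first by rewrite ri (jn _ _ iv); lia.
  apply: ESeq ex _; rewrite -r2; exact: EInc.
by move=> s'; apply: gen.
Qed.

(** With nonzero read as true, [ESum] is also a bounded existential quantifier, products are
    conjunctions and sums are disjunctions. *)
Inductive exp :=
| EVar of nat
| ENum of nat
| EAdd of exp & exp
| EMul of exp & exp
| EEq of exp & exp
| ELt of exp & exp
| EBit of exp
| ESum of nat & exp & exp.

Fixpoint eval (M : nat -> bool) (r : nat -> nat) (e : exp) : nat :=
  match e with
  | EVar x => r x
  | ENum n => n
  | EAdd e1 e2 => eval M r e1 + eval M r e2
  | EMul e1 e2 => eval M r e1 * eval M r e2
  | EEq e1 e2 => eval M r e1 == eval M r e2
  | ELt e1 e2 => eval M r e1 < eval M r e2
  | EBit e => M (eval M r e)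
  | ESum x e1 e2 => \sum_(i < eval M r e1) eval M (fset r x i) e2
  end.

Fixpoint rincs (j n : nat) : rm :=
  if n is n'.+1 then RSeq (rincs j n') (RInc j) else RClr j.

(* The value of the expression is left in register d; registers below d are
   preserved, and loc maps the variables to registers below d. *)
Fixpoint ecode (e : exp) (loc : nat -> nat) (d : nat) : rm :=
  match e with
  | EVar x => RSeq (RClr d) (rfor d.+1 (loc x) (RInc d))
  | ENum n => rincs d n
  | EAdd e1 e2 => RSeq (ecode e1 loc d) (RSeq (ecode e2 loc d.+1)
      (rfor d.+2 d.+1 (RInc d)))
  | EMul e1 e2 => RSeq (ecode e1 loc d.+1) (RSeq (ecode e2 loc d.+2)
      (RSeq (RClr d) (rfor d.+3 d.+1 (rfor d.+4 d.+2 (RInc d)))))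
  | EEq e1 e2 => RSeq (ecode e1 loc d.+1) (RSeq (ecode e2 loc d.+2)
      (RSeq (RClr d) (RIfEq d.+1 d.+2 (RInc d) RSkip)))
  | ELt e1 e2 => RSeq (ecode e1 loc d.+1) (RSeq (ecode e2 loc d.+2)
      (RSeq (RClr d) (rfor d.+3 d.+2 (RIfEq d.+3 d.+1 (RInc d) RSkip))))
  | EBit e => RSeq (ecode e loc d.+1) (RSeq (RClr d) (RIfBit d.+1 (RInc d) RSkip))
  | ESum x e1 e2 => RSeq (ecode e1 loc d.+1) (RSeq (RClr d) (rfor d.+2 d.+1
      (RSeq (ecode e2 (fset loc x d.+2) d.+3) (rfor d.+4 d.+3 (RInc d)))))
  end.

Lemma rsafe_ecode e loc d : 0 < d -> rsafe (ecode e loc d).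
Proof.
elim: e loc d => /=.
- by move=> x loc d ->.
- by move=> n loc d d0; elim: n => //= n ->.
- by move=> e1 IH1 e2 IH2 loc d d0; rewrite IH1 // IH2 // d0.
- by move=> e1 IH1 e2 IH2 loc d d0; rewrite IH1 // IH2 // d0.
- by move=> e1 IH1 e2 IH2 loc d d0; rewrite IH1 // IH2 // d0.
- by move=> e1 IH1 e2 IH2 loc d d0; rewrite IH1 // IH2 // d0.
- by move=> e IH loc d d0; rewrite IH // d0.
- by move=> x e1 IH1 e2 IH2 loc d d0; rewrite IH1 // IH2 // d0.
Qed.

Definition preserves (d : nat) (s s' : rstate) : Prop :=
  [/\ forall r, r < d -> reg s' r = reg s r, ram s' = ram s & io s' = io s].

Lemma preserves_refl d s : preserves d s s.
Proof. by []. Qed.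

Lemma preserves_trans d d' s1 s2 s3 : d <= d' ->
  preserves d s1 s2 -> preserves d' s2 s3 -> preserves d s1 s3.
Proof.
move=> le [r1 m1 i1] [r2 m2 i2]; split; rewrite ?m2 ?i2 //.
by move=> r rd; rewrite r2 ?r1 //; lia.
Qed.

Lemma preserves_set d s j v : d <= j -> preserves d s (set_reg s j v).
Proof. by move=> le; split=> //= r rd; rewrite /fset; case: eqP => //; lia. Qed.

Lemma fset_eq (T : Type) (f : nat -> T) x v : fset f x v x = v.
Proof. by rewrite /fset eqxx. Qed.

Lemma fset_ne (T : Type) (f : nat -> T) x v y : y <> x -> fset f x v y = f y.
Proof. by rewrite /fset; case: eqP. Qed.

Ltac fset_lia := rewrite /= /fset; repeat (case: eqP => ?); try lia; try done.

Lemma halts_add d i j s : i <> d -> j <> d -> i <> j ->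
  halts_in (rfor i j (RInc d)) s (reg s j * 3 + 2)
    (fun s' => [/\ reg s' d = reg s d + reg s j, ram s' = ram s, io s' = io s
                 & forall r, r <> d -> r <> i -> reg s' r = reg s r]).
Proof.
move=> id jd ij.
pose Inv k s' := [/\ reg s' d = reg s d + k, ram s' = ram s, io s' = io s
                 & forall r, r <> d -> r <> i -> reg s' r = reg s r].
apply: (halts_weaken (T := reg s j * 3 + 2)
    (P := fun s' => Inv (reg s j) s' /\ reg s' i = reg s j)) => //;
  last by move=> s' [].
apply: (@halts_for _ _ _ _ _ _ 1).
- by move=> k s' [_ _ _]; apply=> // /esym.
- split=> //=; first by rewrite fset_ne ?addn0 // => /esym.
  by move=> r _ ri; rewrite fset_ne.
- move=> k s' kn [a b c e] ri; apply: halts_inc; split=> /=.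
    by rewrite fset_ne.
  split=> //=.
  + by rewrite fset_ne ?fset_eq ?a ?addnS // => /esym.
  + by move=> r rd rni; rewrite !fset_ne // e.
Qed.

Definition env_ok (loc r : nat -> nat) (d : nat) (s : rstate) : Prop :=
  forall x, loc x < d /\ reg s (loc x) = r x.

Lemma env_ok_preserves loc r d d' s s' : d <= d' ->
  env_ok loc r d s -> preserves d s s' -> env_ok loc r d' s'.
Proof.
move=> le ok [p _ _] x; have [a b] := ok x.
by rewrite p //; split=> //; apply: leq_trans le.
Qed.

Lemma env_ok_bind loc r d d' s s' x v : d <= d' ->
  env_ok loc r d s -> preserves d s s' -> reg s' d' = v ->
  env_ok (fset loc x d') (fset r x v) d'.+1 s'.
Proof.
move=> le ok p rv y; rewrite /fset; case: eqP => // _.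
by have [a b] := env_ok_preserves le ok p y; split=> //; apply: ltnW.
Qed.

(** The value bound [v] is carried along because values become numbers of iterations. Both bounds
    are uniform in the memory, whose bits contribute only 0 or 1. *)
Definition ecode_correct (e : exp) (v f : nat -> nat) : Prop :=
  [/\ polyb v, polyb f,
      forall M r B, (forall x, r x <= B) -> eval M r e <= v B
    & forall loc r d s B, 0 < d -> (forall x, r x <= B) -> env_ok loc r d s ->
      halts_in (ecode e loc d) s (f B)
        (fun s' => preserves d s s' /\ reg s' d = eval (ram s) r e)].

Lemma ecodeP e : exists v f, ecode_correct e v f.
Proof.
elim: e.
- move=> x; exists id, (fun B => 1 + (B * 3 + 2)); split=> //; first solve_polyb.
  + by solve_polyb.
  + by move=> M r B /= rB; apply: rB.
  move=> loc r d s B d0 rB ok.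
  have [lx rx] := ok x.
  apply: (halts_weaken (T := 1 + (r x * 3 + 2)) (P := _)) => //.
  + apply: (halts_seq (P := fun s' => s' = set_reg s d 0)).
      by apply: halts_clr.
    move=> _ ->; have := @halts_add d d.+1 (loc x) (set_reg s d 0).
    rewrite /= fset_ne ?rx; [apply|]; lia.
  + by have := rB x; lia.
  + move=> s' [/= a b c e]; split; last by rewrite a fset_eq.
    split=> // r' lt; rewrite e ?fset_ne //; lia.
- move=> n; exists (fun=> n), (fun=> n.+1); split=> //; try solve_polyb.
  move=> loc r d s B d0 rB ok /=.
  elim: n => [|n IH] /=.
    by apply: halts_clr; split; [exact: preserves_set|exact: fset_eq].
  rewrite -addn1; apply: halts_seq IH _ => s' [p q].
  apply: halts_inc; split; last by rewrite /= fset_eq q.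
  by apply: preserves_trans p _; [exact: leqnn|exact: preserves_set].
- move=> e1 [v1 [f1 [pv1 pf1 le1 H1]]] e2 [v2 [f2 [pv2 pf2 le2 H2]]].
  exists (fun B => v1 B + v2 B), (fun B => f1 B + (f2 B + (v2 B * 3 + 2))).
  split; try solve_polyb.
  + by move=> M r B rB; apply: leq_add; auto.
  move=> loc r d s B d0 rB ok /=.
  apply: halts_seq (H1 _ _ _ _ _ d0 rB ok) _ => s1 [p1 q1].
  have ok1 := env_ok_preserves (leqnSn d) ok p1.
  apply: halts_seq (H2 _ _ _ _ _ _ rB ok1) _ => // s2 [p2 q2].
  apply: halts_weaken (halts_add _ _ _ _) _ _; try lia.
    by rewrite q2; have := le2 (ram s1) r B rB; lia.
  move=> s3 [a b c h].
  have p3 : preserves d s2 s3 by split=> // r' lt; apply: h; lia.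
  split.
    exact: preserves_trans (leqnn d) (preserves_trans (leqnSn d) p1 p2) p3.
  case: p2 => g _ _; case: p1 => _ m1 _.
  by rewrite a q2 g // q1 m1.
- move=> e1 [v1 [f1 [pv1 pf1 le1 H1]]] e2 [v2 [f2 [pv2 pf2 le2 H2]]].
  exists (fun B => v1 B * v2 B),
    (fun B => f1 B + (f2 B + (1 + (v1 B * ((v2 B * 3 + 2) + 2) + 2)))).
  split; try solve_polyb.
  + by move=> M r B rB; apply: leq_mul; auto.
  move=> loc r d s B d0 rB ok /=.
  have ok0 := env_ok_preserves (leqnSn d) ok (preserves_refl _ _).
  apply: halts_seq (H1 _ _ _ _ _ _ rB ok0) _ => // s1 [p1 q1].
  have ok1 := env_ok_preserves (leqnSn d.+1) ok0 p1.
  apply: halts_seq (H2 _ _ _ _ _ _ rB ok1) _ => // s2 [p2 q2].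
  have L2 : reg s2 d.+2 <= v2 B by rewrite q2; exact: le2.
  have L1 : reg s2 d.+1 <= v1 B by case: p2 => g _ _; rewrite g // q1; exact: le1.
  apply: (halts_seq (P := fun s' => s' = set_reg s2 d 0)); first exact: halts_clr.
  move=> _ ->.
  pose Inv k s' := [/\ reg s' d = k * reg s2 d.+2, preserves d s2 s',
     reg s' d.+1 = reg s2 d.+1 & reg s' d.+2 = reg s2 d.+2].
  apply: (halts_weaken (T := reg s2 d.+1 * (reg s2 d.+2 * 3 + 2).+2 + 2)
    (P := fun s' => Inv (reg s2 d.+1) s' /\ reg s' d.+3 = reg s2 d.+1)).
  + apply: halts_for.
    * by move=> k s' [].
    * split; try by [rewrite ?mul0n; fset_lia].
      by split=> //= r' lt; rewrite !fset_ne //; lia.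
    * move=> k s' kn [a b c e] ri.
      apply: halts_weaken (halts_add _ _ _ _) _ _; try lia.
      move=> s3 [a3 b3 c3 h3]; split; first by rewrite h3 //; lia.
      split=> /=.
      -- by rewrite fset_ne ?a3 ?a ?e; [rewrite mulSn addnC|lia].
      -- apply: preserves_trans (leqnn d) b _; split=> //= r' lt.
         by rewrite fset_ne ?h3 //; lia.
      -- by rewrite fset_ne ?h3 //; lia.
      -- by rewrite fset_ne ?h3 //; lia.
  + have : reg s2 d.+1 * (reg s2 d.+2 * 3 + 2).+2 <= v1 B * (v2 B * 3 + 2 + 2).
      by apply: leq_mul; lia.
    by lia.
  + move=> s3 [[a b c e] _]; split.
      apply: preserves_trans (leqnn d) _ b.
      by apply: preserves_trans (preserves_trans (leqnSn d) (preserves_refl d s) p1) p2; lia.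
    case: p2 => g _ _; case: p1 => _ m1 _.
    by rewrite a g // q1 q2 m1.
- move=> e1 [v1 [f1 [pv1 pf1 le1 H1]]] e2 [v2 [f2 [pv2 pf2 le2 H2]]].
  exists (fun=> 1), (fun B => f1 B + (f2 B + (1 + 2))).
  split; try solve_polyb.
  + by move=> M r B rB /=; case: (_ == _).
  move=> loc r d s B d0 rB ok /=.
  have ok0 := env_ok_preserves (leqnSn d) ok (preserves_refl _ _).
  apply: halts_seq (H1 _ _ _ _ _ _ rB ok0) _ => // s1 [p1 q1].
  have ok1 := env_ok_preserves (leqnSn d.+1) ok0 p1.
  apply: halts_seq (H2 _ _ _ _ _ _ rB ok1) _ => // s2 [p2 q2].
  apply: (halts_seq (P := fun s' => s' = set_reg s2 d 0)); first exact: halts_clr.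
  move=> _ ->; apply: halts_ifeq.
  have p : preserves d s s2.
    by apply: preserves_trans (preserves_trans (leqnSn d) (preserves_refl d s) p1) p2; lia.
  have <- : (reg s2 d.+1 == reg s2 d.+2) = (eval (ram s) r e1 == eval (ram s) r e2).
    by case: p2 => g _ _; case: p1 => _ m1 _; rewrite g // q1 q2 m1.
  rewrite /= !fset_ne; try lia.
  have p0 : preserves d s (set_reg s2 d 0).
    exact: preserves_trans (leqnn d) p (preserves_set _ _ (leqnn d)).
  case: eqP => _.
    apply: halts_inc; split; last by rewrite /= !fset_eq.
    exact: preserves_trans (leqnn d) p0 (preserves_set _ _ (leqnn d)).
  apply: halts_skip.
  by split; rewrite //= fset_eq.
- move=> e1 [v1 [f1 [pv1 pf1 le1 H1]]] e2 [v2 [f2 [pv2 pf2 le2 H2]]].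
  exists (fun=> 1), (fun B => f1 B + (f2 B + (1 + (v2 B * 4 + 2)))).
  split; try solve_polyb.
  + by move=> M r B rB /=; case: (_ < _).
  move=> loc r d s B d0 rB ok /=.
  have ok0 := env_ok_preserves (leqnSn d) ok (preserves_refl _ _).
  apply: halts_seq (H1 _ _ _ _ _ _ rB ok0) _ => // s1 [p1 q1].
  have ok1 := env_ok_preserves (leqnSn d.+1) ok0 p1.
  apply: halts_seq (H2 _ _ _ _ _ _ rB ok1) _ => // s2 [p2 q2].
  have L2 : reg s2 d.+2 <= v2 B by rewrite q2; exact: le2.
  apply: (halts_seq (P := fun s' => s' = set_reg s2 d 0)); first exact: halts_clr.
  move=> _ ->.
  have p : preserves d s s2.
    by apply: preserves_trans (preserves_trans (leqnSn d) (preserves_refl d s) p1) p2; lia.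
  have <- : (reg s2 d.+1 < reg s2 d.+2) = (eval (ram s) r e1 < eval (ram s) r e2).
    by case: p2 => g _ _; case: p1 => _ m1 _; rewrite g // q1 q2 m1.
  (* The counter runs through all numbers below the second operand and meets the first operand,
     once, iff that one is smaller. *)
  pose Inv k s' := [/\ reg s' d = (reg s2 d.+1 < k), preserves d s2 s',
     reg s' d.+1 = reg s2 d.+1 & reg s' d.+2 = reg s2 d.+2].
  apply: (halts_weaken (T := reg s2 d.+2 * 4 + 2)
    (P := fun s' => Inv (reg s2 d.+2) s' /\ reg s' d.+3 = reg s2 d.+2)).
  + apply: halts_for.
    * by move=> k s' [].
    * split; try by [fset_lia].
      by split=> //= r' lt; rewrite !fset_ne //; lia.
    * move=> k s' kn [a b c e] ri; apply: halts_ifeq; rewrite ri c.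
      have bs s3 : preserves d s' s3 -> preserves d s2 (set_reg s3 d.+3 k.+1).
        move=> h; apply: preserves_trans (leqnn d) b _.
        by apply: preserves_trans (leqnn d) h _; apply: preserves_set; lia.
      case: eqP => E.
        apply: halts_inc; split=> /=; first by rewrite fset_ne //; lia.
        split; try by [fset_lia].
        by apply: bs; apply: preserves_set.
      apply: halts_skip.
      split=> //; split; try by [fset_lia].
      by apply: bs; apply: preserves_refl.
  + by lia.
  + move=> s3 [[a b c e] _]; split=> //.
    exact: preserves_trans (leqnn d) p b.
- move=> e1 [v1 [f1 [pv1 pf1 le1 H1]]].
  exists (fun=> 1), (fun B => f1 B + (1 + 2)).
  split; try solve_polyb.
  + by move=> M r B rB /=; case: (M _).
  move=> loc r d s B d0 rB ok /=.
  have ok0 := env_ok_preserves (leqnSn d) ok (preserves_refl _ _).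
  apply: halts_seq (H1 _ _ _ _ _ _ rB ok0) _ => // s1 [p1 q1].
  apply: (halts_seq (P := fun s' => s' = set_reg s1 d 0)); first exact: halts_clr.
  move=> _ ->; apply: halts_ifbit.
  have p : preserves d s s1.
    by apply: preserves_trans (leqnSn d) (preserves_refl d s) p1.
  have <- : ram s1 (reg s1 d.+1) = ram s (eval (ram s) r e1).
    by case: p1 => _ -> _; rewrite q1.
  rewrite /= !fset_ne; try lia.
  have p0 : preserves d s (set_reg s1 d 0).
    exact: preserves_trans (leqnn d) p (preserves_set _ _ (leqnn d)).
  case: (ram s1 _).
    apply: halts_inc; split; last by rewrite /= !fset_eq.
    exact: preserves_trans (leqnn d) p0 (preserves_set _ _ (leqnn d)).
  apply: halts_skip.
  by split; rewrite //= fset_eq.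
- move=> x e1 [v1 [f1 [pv1 pf1 le1 H1]]] e2 [v2 [f2 [pv2 pf2 le2 H2]]].
  (* The summation index stays below [v1 B], so the body is evaluated under variables bounded by
     [B + v1 B]. *)
  exists (fun B => v1 B * v2 (B + v1 B)),
    (fun B => f1 B + (1 + (v1 B * ((f2 (B + v1 B) + (v2 (B + v1 B) * 3 + 2)) + 2) + 2))).
  split; try solve_polyb.
  + move=> M r B rB /=.
    have n1 := le1 M r B rB.
    apply: (@leq_trans (\sum_(i < eval M r e1) v2 (B + v1 B))).
      apply: leq_sum => i _; apply: le2 => y; rewrite /fset; case: eqP => _.
        by have := ltn_ord i; lia.
      by have := rB y; lia.
    by rewrite sum_nat_const card_ord leq_mul2r n1 orbT.
  move=> loc r d s B d0 rB ok /=.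
  have ok0 := env_ok_preserves (leqnSn d) ok (preserves_refl _ _).
  apply: halts_seq (H1 _ _ _ _ _ _ rB ok0) _ => // s1 [p1 q1].
  apply: (halts_seq (P := fun s' => s' = set_reg s1 d 0)); first exact: halts_clr.
  move=> _ ->; set n := eval (ram s) r e1 in q1 *.
  have nv : n <= v1 B by exact: le1.
  have p : preserves d s s1 by apply: preserves_trans (leqnSn d) (preserves_refl d s) p1.
  pose Inv k s' := [/\ reg s' d = \sum_(i < k) eval (ram s) (fset r x i) e2,
     preserves d s s' & reg s' d.+1 = n].
  apply: (halts_weaken (T := n * (f2 (B + v1 B) + (v2 (B + v1 B) * 3 + 2)).+2 + 2)
    (P := fun s' => Inv n s' /\ reg s' d.+2 = n)).
  + apply: halts_for.
    * by move=> k s' [].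
    * split; try by [rewrite ?big_ord0; fset_lia].
      apply: preserves_trans (leqnn d) p _.
      by split=> //= r' lt; rewrite !fset_ne //; lia.
    * move=> k s' kn [a b c] ri.
      have rB' y : fset r x k y <= B + v1 B.
        by rewrite /fset; case: eqP => _; [|have := rB y]; lia.
      have ok2 : env_ok (fset loc x d.+2) (fset r x k) d.+3 s'.
        by apply: env_ok_bind ok b ri; lia.
      apply: halts_seq (H2 _ _ _ _ _ _ rB' ok2) _ => // s2 [p2 q2].
      have ms : ram s' = ram s by case: b.
      apply: halts_weaken (halts_add _ _ _ _) _ _; try lia.
        by rewrite q2; have := le2 (ram s') _ _ rB'; lia.
      move=> s3 [a3 b3 c3 h3]; have [g _ _] := p2.
      split; first by rewrite h3 ?g //; lia.
      split=> /=.
      -- rewrite fset_ne ?a3 ?q2 ?g ?a ?big_ord_recr /= ?ms //; lia.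
      -- apply: preserves_trans (leqnn d) (preserves_trans _ b p2) _; first by lia.
         by split=> //= r' lt; rewrite fset_ne ?h3 //; lia.
      -- by rewrite fset_ne ?h3 ?g ?c //; lia.
  + have : n * (f2 (B + v1 B) + (v2 (B + v1 B) * 3 + 2)).+2
        <= v1 B * (f2 (B + v1 B) + (v2 (B + v1 B) * 3 + 2) + 2).
      by apply: leq_mul; lia.
    by lia.
  + by move=> s3 [[a b c] _].
Qed.

(** * Programs over a bit array and an output string *)

Inductive prog :=
| PSkip
| PSeq of prog & prog
| PIf of exp & prog & prog
| PFor of nat & exp & prog
| PLet of nat & exp & prog
| PSet of exp
| PPush of bool.

Definition store := ((nat -> bool) * seq bool)%type.

(** Variables are bound by [PFor] and [PLet] but never assigned, so the environment is a mere
    parameter and only the store is threaded through. *)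
Fixpoint run (p : prog) (r : nat -> nat) (st : store) : store :=
  match p with
  | PSkip => st
  | PSeq p1 p2 => run p2 r (run p1 r st)
  | PIf e p1 p2 => if eval st.1 r e != 0 then run p1 r st else run p2 r st
  | PFor x e p => foldl (fun st i => run p (fset r x i) st) st (iota 0 (eval st.1 r e))
  | PLet x e p => run p (fset r x (eval st.1 r e)) st
  | PSet e => (fset st.1 (eval st.1 r e) true, st.2)
  | PPush b => (st.1, rcons st.2 b)
  end.

Fixpoint pcode (p : prog) (loc : nat -> nat) (d : nat) : rm :=
  match p with
  | PSkip => RSkip
  | PSeq p1 p2 => RSeq (pcode p1 loc d) (pcode p2 loc d)
  | PIf e p1 p2 => RSeq (ecode e loc d) (RSeq (RClr d.+1)
      (RIfEq d d.+1 (pcode p2 loc d) (pcode p1 loc d)))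
  | PFor x e p => RSeq (ecode e loc d) (rfor d.+1 d (pcode p (fset loc x d.+1) d.+2))
  | PLet x e p => RSeq (ecode e loc d) (pcode p (fset loc x d) d.+1)
  | PSet e => RSeq (ecode e loc d) (RSet d)
  | PPush b => RPush b
  end.

Lemma rsafe_pcode p loc d : 0 < d -> rsafe (pcode p loc d).
Proof.
elim: p loc d => //=.
- by move=> p1 IH1 p2 IH2 loc d d0; rewrite IH1 // IH2.
- by move=> e p1 IH1 p2 IH2 loc d d0; rewrite rsafe_ecode // IH1 // IH2.
- by move=> x e p IH loc d d0; rewrite rsafe_ecode // IH.
- by move=> x e p IH loc d d0; rewrite rsafe_ecode // IH.
- by move=> e loc d d0; rewrite rsafe_ecode.
Qed.

Definition same_regs (d : nat) (s s' : rstate) : Prop :=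
  forall r, r < d -> reg s' r = reg s r.

Definition store_of (s : rstate) : store := (ram s, io s).

Lemma store_of_preserves d s s' : preserves d s s' -> store_of s' = store_of s.
Proof. by case=> _ m1 i1; rewrite /store_of m1 i1. Qed.

Lemma env_ok_same loc r d d' s s' : d <= d' -> env_ok loc r d s ->
  same_regs d s s' -> env_ok loc r d' s'.
Proof.
move=> le ok p x; have [a b] := ok x.
by rewrite p //; split=> //; apply: leq_trans le.
Qed.

(** Loop bounds are expressions, whose values are bounded independently of the memory; hence the
    time depends on the bound of the variables alone, whatever the store has become. *)
Lemma pcodeP p : exists2 f, polyb f & forall loc r d s B, 0 < d ->
  (forall x, r x <= B) -> env_ok loc r d s ->
  halts_in (pcode p loc d) s (f B)
    (fun s' => same_regs d s s' /\ store_of s' = run p r (store_of s)).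
Proof.
elim: p.
- by exists (fun=> 0); [solve_polyb|move=> *; exact: halts_skip].
- move=> p1 [f1 pf1 H1] p2 [f2 pf2 H2].
  exists (fun B => f1 B + f2 B); first solve_polyb.
  move=> loc r d s B d0 rB ok /=.
  apply: halts_seq (H1 _ _ _ _ _ d0 rB ok) _ => s1 [p q].
  have ok1 := env_ok_same (leqnn d) ok p.
  apply: halts_weaken (H2 _ _ _ _ _ d0 rB ok1) (leqnn _) _ => s2 [p' q'].
  by rewrite q' q; split=> // x lt; rewrite p' ?p.
- move=> e p1 [f1 pf1 H1] p2 [f2 pf2 H2].
  have [v [f [pv pf _ He]]] := ecodeP e.
  exists (fun B => f B + (1 + (f1 B + f2 B + 1))); first solve_polyb.
  move=> loc r d s B d0 rB ok /=.
  apply: halts_seq (He _ _ _ _ _ d0 rB ok) _ => s1 [p q].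
  apply: (halts_seq (P := fun s' => s' = set_reg s1 d.+1 0)); first exact: halts_clr.
  move=> _ ->; rewrite addn1; apply: halts_ifeq.
  have dn : d <> d.+1 by lia.
  rewrite /= fset_eq fset_ne // q.
  set s2 := set_reg s1 d.+1 0.
  have p2' : preserves d s s2.
    by apply: preserves_trans (leqnn d) p _; apply: preserves_set.
  have ok2 := env_ok_preserves (leqnn d) ok p2'.
  rewrite -(store_of_preserves p2').
  case: eqP => _.
    apply: halts_weaken (H2 _ _ _ _ _ d0 rB ok2) (leq_addl _ _) _ => s3 [a b].
    by split=> // x lt; case: p2' => c _ _; rewrite a ?c.
  apply: halts_weaken (H1 _ _ _ _ _ d0 rB ok2) (leq_addr _ _) _ => s3 [a b].
  by split=> // x lt; case: p2' => c _ _; rewrite a ?c.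
- move=> x e p [g pg H].
  have [v [f [pv pf le He]]] := ecodeP e.
  exists (fun B => f B + (v B * (g (B + v B) + 2) + 2)); first solve_polyb.
  move=> loc r d s B d0 rB ok /=.
  apply: halts_seq (He _ _ _ _ _ d0 rB ok) _ => s1 [p1 q1].
  set n := eval (ram s) r e in q1 *.
  have nv : n <= v B by exact: le.
  pose Inv k s' := [/\ same_regs d s s', reg s' d = n &
    store_of s' = foldl (fun st i => run p (fset r x i) st) (store_of s) (iota 0 k)].
  apply: (halts_weaken (T := n * (g (B + v B)).+2 + 2)
    (P := fun s' => Inv n s' /\ reg s' d.+1 = n)).
  + apply: halts_for.
    * by move=> k s' [].
    * split; try by [fset_lia].
        by move=> y lt; rewrite /= fset_ne; [case: p1 => c _ _; rewrite c|lia].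
      by rewrite -(store_of_preserves p1).
    * move=> k s' kn [a b c] ri.
      have rB' y : fset r x k y <= B + v B.
        by rewrite /fset; case: eqP => _; [|have := rB y]; lia.
      have ok2 : env_ok (fset loc x d.+1) (fset r x k) d.+2 s'.
        move=> y; rewrite /fset; case: eqP => // _.
        by have [h1 h2] := env_ok_same (leqnn d) ok a y; split=> //; lia.
      apply: halts_weaken (H _ _ _ _ _ _ rB' ok2) (leqnn _) _ => // s2 [h1 h2].
      split; first by rewrite h1.
      split.
      -- by move=> y lt; rewrite /= fset_ne ?h1 ?a //; lia.
      -- by rewrite /= fset_ne ?h1 //; lia.
      -- by have := iotaD 0 k 1; rewrite addn1 => ->; rewrite foldl_cat /= -c -h2.
  + have : n * (g (B + v B)).+2 <= v B * (g (B + v B) + 2) by apply: leq_mul; lia.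
    by lia.
  + by move=> s3 [[a b c] _].
- move=> x e p [g pg H].
  have [v [f [pv pf le He]]] := ecodeP e.
  exists (fun B => f B + g (B + v B)); first solve_polyb.
  move=> loc r d s B d0 rB ok /=.
  apply: halts_seq (He _ _ _ _ _ d0 rB ok) _ => s1 [p1 q1].
  set n := eval (ram s) r e in q1 *.
  have nv : n <= v B by exact: le.
  have rB' y : fset r x n y <= B + v B.
    by rewrite /fset; case: eqP => _; [|have := rB y]; lia.
  have ok1 := env_ok_bind x (leqnn d) ok p1 q1.
  apply: halts_weaken (H _ _ _ _ _ _ rB' ok1) (leqnn _) _ => // s2 [a b].
  rewrite b (store_of_preserves p1); split=> // y lt.
  by rewrite a; [case: p1 => c _ _; rewrite c|lia].
- move=> e.
  have [v [f [pv pf le He]]] := ecodeP e.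
  exists (fun B => f B + 1); first solve_polyb.
  move=> loc r d s B d0 rB ok /=.
  apply: halts_seq (He _ _ _ _ _ d0 rB ok) _ => s1 [[p1 m1 i1] q1].
  exists (set_mem s1 (reg s1 d) true), 1; split=> //; first by constructor.
  split; first by move=> y lt; rewrite /= p1.
  by rewrite /store_of /= m1 i1 q1.
- move=> b; exists (fun=> 1); first solve_polyb.
  move=> loc r d s B d0 rB ok /=.
  exists (set_io s (rcons (io s) b)), 1; split=> //; exact: EPush.
Qed.

(* Pops the input into the memory, which therefore holds it reversed; the
   length of the input is left in register 1. *)
Definition rload : rm :=
  RSeq (RInc 3) (RWhileNe 2 3
    (RIfPop (RInc 2) (RSeq (RSet 1) (RInc 1)) (RInc 1))).

Definition loaded (x : seq bool) (n : nat) : nat -> bool :=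
  fun i => (i < n) && nth false (rev x) i.

Lemma rloadP x : halts_in rload (rinit x) (4 * size x + 5)
  (fun s => [/\ reg s 0 = 0, reg s 1 = size x & store_of s = (nth false (rev x), [::])]).
Proof.
(* Registers 2 and 3 form the loop switch: 3 holds 1, and 2 is raised to 1 when the input is
   exhausted. *)
pose Inv k s := [/\ reg s 0 = 0, reg s 1 = k, reg s 2 = 0, reg s 3 = 1
   & ram s = loaded x k /\ io s = take (size x - k) x].
have -> : 4 * size x + 5 = 1 + (4 * size x + 4) by lia.
apply: (halts_seq (P := Inv 0)).
  apply: halts_inc; split=> //=; rewrite subn0 take_size; split=> //.
suff gen d k s : k + d = size x -> Inv k s ->
  halts_in (RWhileNe 2 3 (RIfPop (RInc 2) (RSeq (RSet 1) (RInc 1)) (RInc 1))) s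
    (4 * d + 4) (fun s => [/\ reg s 0 = 0, reg s 1 = size x
      & store_of s = (nth false (rev x), [::])]).
  by move=> s; apply: gen.
elim: d k s => [|d IH] k s e [r0 r1 r2 r3 [ms is_]].
  have ek : k = size x by lia.
  exists (set_reg s 2 1), 4; split=> //.
    apply: (@EWhileT _ _ _ _ (set_reg s 2 1) _ 2 1); first by rewrite r2 r3.
      apply: EIfPop0; first by rewrite is_ ek subnn take0.
      by have := EInc 2 s; rewrite r2.
    by apply: EWhileF; rewrite /= /fset /= r3.
  split=> //=; first by rewrite /fset /= r1.
  rewrite /store_of /= is_ ek subnn take0 ms; congr pair.
  apply: functional_extensionality => i; rewrite /loaded ek.
  by case: ltnP => // h; rewrite nth_default // size_rev.
have kx : k < size x by lia.
pose b := nth false x (size x - k.+1).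
have E : io s = rcons (take (size x - k.+1) x) b.
  rewrite is_ -take_nth; last by lia.
  by congr take; lia.
have lk : loaded x k.+1 = fset (loaded x k) k b.
  apply: functional_extensionality => i; rewrite /loaded /fset ltnS.
  case: ltngtP => // [->]; by rewrite nth_rev.
pose s1 := set_io s (take (size x - k.+1) x).
pose s2 := set_reg (if b then set_mem s1 k true else s1) 1 k.+1.
have [|| s3 [t [le ex q]]] := IH k.+1 s2; first by lia.
  rewrite /s2 /Inv; case eb : b => /=; split=> //; split=> //; rewrite lk eb ms //.
  apply: functional_extensionality => i; rewrite /fset; case: eqP => // ->.
  by rewrite /loaded ltnn.
exists s3; rewrite /s2 in ex; case eb : b ex => ex.
- exists ((2.+1) + t).+1; split=> //; first by lia.
  apply: EWhileT ex; first by rewrite r2 r3.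
  apply: (@EIfPop _ _ _ _ _ _ _ _ E); rewrite eb -/s1.
  have h1 := ESet 1 s1; rewrite /= r1 in h1.
  by have h2 := EInc 1 (set_mem s1 k true); rewrite /= r1 in h2; exact: ESeq h1 h2.
- exists ((1.+1) + t).+1; split=> //; first by lia.
  apply: EWhileT ex; first by rewrite r2 r3.
  apply: (@EIfPop _ _ _ _ _ _ _ _ E); rewrite eb -/s1.
  by have h2 := EInc 1 s1; rewrite /= r1 in h2; exact: h2.
Qed.

Definition length_env (n : nat) : nat -> nat := fset (fun=> 0) 0 n.

Theorem prog_computes (p : prog) : exists (M : TM) a d, forall x,
  tm_computes_within M x (a * (size x).+1 ^ d)
    (run p (length_env (size x)) (nth false (rev x), [::])).2.
Proof.
have [f pf H] := pcodeP p.
(* Variable 0 sits in register 1, where [rload] leaves the input length. All other variables share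
   register 0, which is constantly 0. Registers 2 and 3 were used in loading, so free registers
   start at 4. *)
pose c := RSeq rload (pcode p (fset (fun=> 0) 0 1) 4).
have [M [K MK]] : exists M K, forall x s' T,
    rexec c (rinit x) s' T ->
    tm_computes_within M x (K * (size x + T).+1 ^ 2) (io s').
  by apply: rm_machine; rewrite /= rsafe_pcode.
pose T n := (4 * n + 5) + f n.
have [D TD] : polyb (fun n => K * ((n + T n + 1) * (n + T n + 1))).
  by rewrite /T; solve_polyb.
(* The factor [2 ^ D] comes from [size x + 2 <= 2 * (size x).+1]. *)
exists M, (2 ^ D), D => x.
have [s' [t [le ex [_ q]]]] : halts_in c (rinit x) (T (size x))
   (fun s' => True /\ store_of s' = run p (length_env (size x)) (nth false (rev x), [::])).
  apply: halts_seq (rloadP x) _ => s1 [r0 r1 st].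
  apply: halts_weaken (H _ (length_env (size x)) _ _ (size x) _ _ _) (leqnn _) _ => //.
  - by move=> y; rewrite /length_env /fset; case: eqP.
  - by move=> y; rewrite /length_env /fset; case: eqP; rewrite ?r0 ?r1.
  - by move=> s2 [_]; rewrite st.
have [t' le' out] := MK _ _ _ ex.
exists t'; last by rewrite -q.
apply: leq_trans le' _; rewrite -expnMn.
apply: (@leq_trans ((size x + 2) ^ D)); last by apply: leq_expW; lia.
apply: leq_trans (TD (size x)).
rewrite leq_mul2l; apply/orP; right.
by rewrite expnS expn1; apply: leq_mul; lia.
Qed.

(** * Greedy choice of tuples *)

Section GreedyTuples.

Variables (c k : nat) (bad : pred (seq nat)).

(** [cap 0] becomes the bound on the number of kept tuples, and [cap c] is 1, so full agreement with
    a kept tuple already forces rejection. For [c = 0] the value is [0 ^ 0 = 1]. *)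
Definition cap (j : nat) : nat := (c * k.+1) ^ (c - j).

Definition agree (I : {set 'I_c}) (t s : seq nat) : bool :=
  [forall i in I, nth 0 t i == nth 0 s i].

Definition agree_count (K : seq (seq nat)) (I : {set 'I_c}) (t : seq nat) : nat :=
  count (agree I t) K.

Definition admissible (K : seq (seq nat)) (t : seq nat) : bool :=
  bad t && [forall I : {set 'I_c}, agree_count K I t < cap #|I|].

Definition keep (K : seq (seq nat)) (t : seq nat) : seq (seq nat) :=
  if admissible K t then t :: K else K.

Definition kept (ts : seq (seq nat)) : seq (seq nat) := foldl keep [::] ts.

Lemma agree_sym I t s : agree I t s = agree I s t.
Proof. by apply: eq_forallb => i; rewrite eq_sym. Qed.

Lemma agree_trans I t s u : agree I t s -> agree I s u -> agree I t u.
Proof.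
move=> /forall_inP h1 /forall_inP h2; apply/forall_inP => i iI.
by rewrite (eqP (h1 i iI)) h2.
Qed.

Lemma kept_rcons ts t : kept (rcons ts t) = keep (kept ts) t.
Proof. by rewrite /kept foldl_rcons. Qed.

Lemma kept_sub ts s : s \in kept ts -> s \in ts /\ bad s.
Proof.
elim/last_ind: ts => // ts t IH; rewrite kept_rcons /keep mem_rcons.
case: ifP => [/andP[bt _]|_]; last by move=> /IH[h ->]; rewrite inE h orbT.
by rewrite !inE => /predU1P[->|/IH[h ->]]; rewrite ?eqxx // h orbT.
Qed.

(** Agreement on [I] is an equivalence relation, so a new tuple enlarges only its own class, which
    was still below the cap. *)
Lemma kept_cap ts I s : s \in kept ts -> agree_count (kept ts) I s <= cap #|I|.
Proof.
elim/last_ind: ts s => // ts t IH s; rewrite kept_rcons /keep.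
case: ifP => [/andP[bt /forallP/(_ I) lt]|_]; last exact: IH.
have aux u : agree I u t -> agree_count (t :: kept ts) I u <= cap #|I|.
  move=> a; rewrite /agree_count /= a add1n.
  suff -> : count (agree I u) (kept ts) = agree_count (kept ts) I t by [].
  apply: eq_count => v; apply/idP/idP; last exact: agree_trans.
  by apply: agree_trans; rewrite agree_sym.
rewrite inE => /predU1P[->|sK]; first by apply: aux; apply/forall_inP.
case a : (agree I s t); first exact: aux.
by rewrite /agree_count /= a add0n; exact: IH.
Qed.

(** Counts only grow, so a cap that was reached when [t] was rejected is still reached at the
    end. *)
Lemma kept_rejected ts t : t \in ts -> bad t ->
  t \in kept ts \/ exists I : {set 'I_c}, cap #|I| <= agree_count (kept ts) I t.
Proof.
elim/last_ind: ts => // ts u IH; rewrite mem_rcons inE kept_rcons => tu bt.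
have mono I : agree_count (kept ts) I t <= agree_count (keep (kept ts) u) I t.
  by rewrite /keep; case: ifP => //= _; exact: leq_addl.
case: (boolP (t \in ts)) => [tin|tnin].
  have [h|[I h]] := IH tin bt; last by right; exists I; exact: leq_trans h (mono I).
  by left; rewrite /keep; case: ifP => // _; rewrite inE h orbT.
move: tu; rewrite (negbTE tnin) orbF => /eqP E; rewrite -E.
rewrite /keep; case: ifP => [_|]; first by left; rewrite mem_head.
rewrite /admissible bt /= => /negbT; rewrite negb_forall => /existsP[I].
by rewrite -leqNgt => h; right; exists I.
Qed.

(* If a rejected tuple t avoids D, then at least cap #|I| kept tuples agree
   with t on some I, and D hits each of them outside I.  By pigeonhole more than
   cap #|I|.+1 of them share one more entry, contradicting kept_cap. *)
Lemma kept_hits (D : seq nat) ts t :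
  size D <= k -> (forall s, s \in ts -> size s = c) ->
  (forall s, s \in kept ts -> has (mem D) s) ->
  t \in ts -> bad t -> has (mem D) t.
Proof.
move=> Dk sz hitK tts bt; apply/negPn/negP => nt.
have [tK|[I le]] := kept_rejected tts bt; first by rewrite hitK in nt.
have tD (i : 'I_c) : nth 0 t i \notin D.
  by apply: contraNN nt => h; apply/hasP; exists (nth 0 t i); rewrite ?mem_nth ?sz.
pose A := [seq s <- kept ts | agree I t s].
have hitA s : s \in A -> exists2 i : 'I_c, i \notin I & nth 0 s i \in D.
  rewrite mem_filter => /andP[a sK]; have [sts _] := kept_sub sK.
  have /hasP[x xs xD] := hitK _ sK.
  have lt : index x s < c by rewrite -(sz _ sts) index_mem.
  exists (Ordinal lt); last by rewrite /= nth_index.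
  apply/negP => iI; have := tD (Ordinal lt).
  by have /forall_inP/(_ _ iI)/eqP-> := a; rewrite /= nth_index //; move: xD => /= ->.
have szA : size A = agree_count (kept ts) I t by rewrite size_filter.
have cap_gt0 j : 0 < c -> 0 < cap j by rewrite /cap expn_gt0 muln_gt0 => ->.
have Alow : cap #|I| <= size A by rewrite szA.
have ne : 0 < size A -> exists s, s \in A.
  by rewrite -has_predT => /hasP[z zA _]; exists z.
(* For [c = 0] the cap is 1, so [A] would have a member, and this member would be hit at an index
   below 0. *)
have c0 : 0 < c.
  case: (posnP c) => // c0.
  have [|z /hitA[i _ _]] := ne; first by apply: leq_trans Alow; rewrite /cap (_ : c - _ = 0) //; lia.
  by have := ltn_ord i; lia.
have Ic : #|I| < c.
  have [|z /hitA[i iI _]] := ne; first by apply: leq_trans Alow; exact: cap_gt0.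
  rewrite -[X in _ < X]card_ord; apply: proper_card; apply/properP; split.
    exact: subset_predT.
  by exists i.
have up : size A <= \sum_(i < c | i \notin I) \sum_(d <- D) cap #|I|.+1.
  apply: (@leq_trans (\sum_(s <- A) \sum_(i < c | i \notin I) \sum_(d <- D) (nth 0 s i == d))).
    rewrite -sum1_size; rewrite big_seq [X in _ <= X]big_seq.
    apply: leq_sum => s sA; have [i iI iD] := hitA s sA.
    rewrite (bigD1 i) //= (big_rem _ iD) /= eqxx; lia.
  rewrite exchange_big /=; apply: leq_sum => i iI.
  rewrite exchange_big /=; apply: leq_sum => d _.
  have -> : \sum_(s <- A) (nth 0 s i == d) = count (fun s => nth 0 s i == d) A.
    by rewrite -sum1_count [RHS]big_mkcond; apply: eq_bigr => s _; case: eqP.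
  case: (posnP (count (fun s => nth 0 s i == d) A)) => [->//|].
  (* [kept_cap] speaks of kept tuples only, so it is applied to a member [s0] of the subclass in
     place of [t]. *)
  rewrite -has_count => /hasP[s0 s0A /eqP e0].
  move: s0A; rewrite mem_filter => /andP[a0 s0K].
  have := kept_cap (i |: I) s0K; rewrite cardsU1 iI add1n; apply: leq_trans.
  rewrite /A count_filter; apply: sub_count => s /= /andP[/eqP es a].
  apply/forall_inP => j; rewrite !inE => /predU1P[->|jI]; first by rewrite e0 es.
  have /forall_inP : agree I s0 s by apply: agree_trans a; rewrite agree_sym.
  exact.
have : size A <= (c * k) * cap #|I|.+1.
  apply: leq_trans up _; rewrite sum_nat_const big_const_seq count_predT iter_addn_0.
  apply: (@leq_trans (c * (k * cap #|I|.+1))); last by rewrite mulnA.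
  apply: leq_mul; last by rewrite mulnC leq_mul2r Dk orbT.
  by apply: leq_trans (max_card _) _; rewrite card_ord.
have capE : cap #|I| = (c * k.+1) * cap #|I|.+1.
  by rewrite /cap -expnS subnSK.
move: Alow; rewrite capE; have := cap_gt0 #|I|.+1 c0.
move: (size A) (cap _) => a q; nia.
Qed.

End GreedyTuples.

(** * The kernel graph *)

Fixpoint tuples (n c : nat) : seq (seq nat) :=
  if c is c'.+1 then [seq x :: s | x <- iota 0 n, s <- tuples n c'] else [:: [::]].

Lemma mem_tuples n c t : (t \in tuples n c) = (size t == c) && all (ltn^~ n) t.
Proof.
elim: c t => [|c IH] [|x t] //=.
  by apply/allpairsP => -[[y s] [_ _]].
rewrite eqSS; apply/allpairsP/andP => [[[y s] [/=]]|[st /andP[xn al]]].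
  by rewrite mem_iota add0n IH => /= yn /andP[ss al] [-> ->]; rewrite yn.
by exists (x, t); split=> //=; rewrite ?mem_iota // IH st.
Qed.

Lemma size_early (P : pred nat) k n :
  size [seq v <- iota 0 n | P v && (count P (iota 0 v) < k)] = minn k (count P (iota 0 n)).
Proof.
elim: n => [|n IH]; first by rewrite minn0.
have -> : iota 0 n.+1 = iota 0 n ++ [:: n] by rewrite -addn1 iotaD.
rewrite filter_cat size_cat IH count_cat /=.
case: (P n) => /=; last by lia.
by case: ltnP => /=; lia.
Qed.

Section Selection.

Variables (F : seq graph) (n k c : nat) (adj : rel nat).

(* Tuples all have length c; one for a smaller H in F is padded with copies of
   its first entry, so that it has the same set of entries as the copy of H. *)
Definition bad_for (t : seq nat) (H : graph) : bool :=
  [&& 0 < gn H,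
      [forall i : 'I_(gn H), forall j : 'I_(gn H), (adj (nth 0 t i) (nth 0 t j) == gadj H i j)
                           && ((i != j) ==> (nth 0 t i != nth 0 t j))]
    & all (fun j => nth 0 t j == nth 0 t 0) (iota (gn H) (c - gn H))].

Definition bad (t : seq nat) : bool := has (bad_for t) F.

Definition kept_tuples : seq (seq nat) := kept c k bad (tuples n c).

Definition core (v : nat) : bool := has (fun s => v \in s) kept_tuples.

(** The first [k] neighbours in vertex order, given by a test that an expression can evaluate
    without storing a list. *)
Definition early (w v : nat) : bool := adj w v && (count (adj w) (iota 0 v) < k).

Definition selected (v : nat) : bool :=
  core v || has (fun w => core w && early w v) (iota 0 n).

Definition survivors : seq nat := [seq v <- iota 0 n | selected v].

Lemma kept_tuplesP s : s \in kept_tuples -> [/\ size s = c, all (ltn^~ n) s & bad s].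
Proof.
by move=> /kept_sub[]; rewrite mem_tuples => /andP[/eqP].
Qed.

Lemma core_lt v : core v -> v < n.
Proof. by case/hasP => s /kept_tuplesP[_ /allP h _] /h. Qed.

(** All tuples agree on the empty index set, so its cap bounds the whole list. *)
Lemma size_kept_tuples : size kept_tuples <= (c * k.+1) ^ c.
Proof.
case E : kept_tuples => [|s l] //; rewrite -E.
have sK : s \in kept_tuples by rewrite E mem_head.
have := kept_cap (set0 : {set 'I_c}) sK.
rewrite /cap cards0 subn0; apply: leq_trans.
rewrite /agree_count; apply: eq_leq; symmetry; apply/eqP; rewrite -all_count.
by apply/allP => u _; apply/forall_inP => i; rewrite inE.
Qed.

(** A kept tuple has [c] entries, and each of them brings itself and at most [k] early
    neighbours. *)
Lemma size_survivors : size survivors <= c * (c * k.+1) ^ c * k.+1.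
Proof.
pose near w := w :: [seq v <- iota 0 n | early w v].
apply: (@leq_trans (size (flatten [seq near w | w <- flatten kept_tuples]))).
  apply: uniq_leq_size; first by rewrite filter_uniq ?iota_uniq.
  move=> v; rewrite mem_filter => /andP[sel vn].
  apply/flatten_mapP; case/orP: sel => [/hasP[s sK vs]|/hasP[w _ /andP[/hasP[s sK ws] e]]].
    by exists v; rewrite ?mem_head //; apply/flattenP; exists s.
  exists w; first by apply/flattenP; exists s.
  by rewrite inE mem_filter e vn orbT.
have near_le w : size (near w) <= k.+1.
  by rewrite /= ltnS size_early geq_minl.
have flat (T : eqType) (ss : seq (seq T)) b :
    (forall s, s \in ss -> size s <= b) -> size (flatten ss) <= b * size ss.
  elim: ss => //= s ss IH h; rewrite size_cat mulnS leq_add ?h ?mem_head //.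
  by apply: IH => u us; apply: h; rewrite inE us orbT.
apply: leq_trans (flat _ _ k.+1 _) _; first by move=> _ /mapP[w _ ->].
rewrite size_map mulnC leq_mul2r; apply/orP; right.
apply: leq_trans (flat _ _ c _) _; first by move=> s /kept_tuplesP[->].
by rewrite leq_mul2l size_kept_tuples orbT.
Qed.

Definition survivor_graph : graph :=
  @Graph (size survivors) (fun i j => adj (nth 0 survivors i) (nth 0 survivors j)).

End Selection.

(** * Equivalence of the instance and its kernel *)

Section Equivalence.

Variables (F : seq graph) (G : graph) (k : nat) (adj : rel nat).
Hypothesis simpleG : simple G.
Hypothesis adjE : forall u v : 'I_(gn G), adj u v = gadj G u v.

Let c := max_order F.
Let n := gn G.
Let us := survivors F n k c adj.
Let G' := survivor_graph F n k c adj.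

Lemma has_graph (P : pred graph) (s : seq graph) :
  has P s <-> exists2 H, List.In H s & P H.
Proof.
elim: s => [|H s IH] /=; first by split=> // -[].
split=> [/orP[PH|/IH[H' i p]]|[H' [<-|i] p]].
- by exists H; [left|].
- by exists H'; [right|].
- by rewrite p.
- by apply/orP; right; apply/IH; exists H'.
Qed.

Lemma survivor_lt (i : 'I_(gn G')) : nth 0 us i < n.
Proof.
have : nth 0 us i \in us by rewrite mem_nth.
by rewrite mem_filter mem_iota => /andP[_].
Qed.

Definition embed (i : 'I_(gn G')) : 'I_n := Ordinal (survivor_lt i).

Lemma embed_inj : injective embed.
Proof.
move=> i j /(congr1 val) /= /eqP; rewrite nth_uniq ?filter_uniq ?iota_uniq //.
by move=> /eqP/val_inj.
Qed.

Lemma embed_onto (v : 'I_n) : selected F n k c adj v -> exists i, embed i = v.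
Proof.
move=> sel; have vus : val v \in us by rewrite mem_filter sel mem_iota ltn_ord.
have lt : index (val v) us < gn G' by rewrite index_mem.
by exists (Ordinal lt); apply: val_inj; rewrite /= nth_index.
Qed.

Lemma adj_survivor (i j : 'I_(gn G')) : gadj G' i j = gadj G (embed i) (embed j).
Proof. by rewrite -adjE. Qed.

Lemma simple_survivor_graph : simple G'.
Proof.
by case: simpleG => sym irr; split=> *; rewrite !adj_survivor.
Qed.

(** The kernel is an induced subgraph: a copy of a forbidden graph there is one in [G], and
    neighbourhoods only shrink. *)
Lemma secluded_survivor : secluded_yes F G k -> secluded_yes F G' k.
Proof.
move=> [S [free le]]; exists (embed @^-1: S); split.
  move=> H HF [phi [inj [out iso]]]; apply: (free H HF).
  exists (embed \o phi); split; first exact: inj_comp embed_inj inj.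
  split=> [i|i j] /=; first by have := out i; rewrite !inE.
  by rewrite iso adj_survivor.
apply: leq_trans le; rewrite -(card_imset _ embed_inj); apply: subset_leq_card.
apply/subsetP => _ /imsetP[v vN ->]; move: vN; rewrite !inE.
case/orP => [->//|/existsP[u /andP[uS a]]]; apply/orP; right.
by apply/existsP; exists (embed u); rewrite -adj_survivor a andbT; rewrite inE in uS.
Qed.

Lemma max_order_ge H : List.In H F -> gn H <= c.
Proof.
rewrite /c /max_order; elim: F => //= H0 s IH [->|i]; rewrite big_cons.
  exact: leq_maxl.
by apply: leq_trans (leq_maxr _ _); exact: IH.
Qed.

(** Entries of kept tuples are core vertices, so the core part of [S'] still meets every kept tuple,
    and [kept_hits] extends this to every forbidden copy in [G]. *)
Lemma survivor_secluded : secluded_yes F G' k -> secluded_yes F G k.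
Proof.
move=> [S' [free' le']].
have S'k : #|S'| <= k by apply: leq_trans le'; apply: subset_leq_card; exact: subsetUl.
pose S := [set embed i | i in S' & core F n k c adj (embed i)].
pose D := [seq val v | v <- enum S].
have Dk : size D <= k.
  rewrite size_map -cardE; apply: leq_trans (leq_imset_card _ _) _.
  by apply: leq_trans S'k; apply: subset_leq_card; apply/subsetP => i; rewrite inE => /andP[].
(* A graph without vertices would embed, by the empty map, into the kernel whatever is deleted. *)
have H0 H : List.In H F -> 0 < gn H.
  move=> HF; case: posnP => // h0; case: (free' H HF).
  have no (i : 'I_(gn H)) : False by have := ltn_ord i; rewrite {2}h0.
  by exists (fun i => False_rect _ (no i)); split=> [i|]; [case: (no i)|split=> i; case: (no i)].
have hitK s : s \in kept_tuples F n k c adj -> has (mem D) s.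
  move=> sK; have [sz /allP sn /has_graph[H HF]] := kept_tuplesP sK.
  case/and3P=> Hpos /forallP emb _; have Hc := max_order_ge HF.
  have cs (i : 'I_(gn H)) : core F n k c adj (nth 0 s i).
    by apply/hasP; exists s => //; apply: mem_nth; rewrite sz; apply: leq_trans Hc.
  (* Core vertices survive, so the copy spanned by [s] lies inside the kernel. *)
  have ex (i : 'I_(gn H)) : exists i' : 'I_(gn G'), nth 0 us i' == nth 0 s i.
    have lt := core_lt (cs i).
    have [|i' e] := @embed_onto (Ordinal lt); first by rewrite /selected /= cs.
    by exists i'; have := congr1 val e => /= ->.
  apply/negPn/negP => nh; apply: (free' H HF).
  pose phi i := xchoose (ex i).
  have phiE i : nth 0 us (phi i) = nth 0 s i by exact: (eqP (xchooseP (ex i))).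
  exists phi; split=> [i j e|]; last split=> [i|i j].
  - have := forallP (emb i) j; case/andP=> _; case: eqP => // _ /=.
    by rewrite -!phiE e eqxx.
  - rewrite inE; apply: contra nh => pS; apply/hasP; exists (nth 0 s i).
      by apply: mem_nth; rewrite sz; apply: leq_trans Hc.
    apply/mapP; exists (embed (phi i)); last by rewrite /= phiE.
    by rewrite mem_enum; apply: imset_f; rewrite inE pS /= phiE cs.
  - by have := forallP (emb i) j; case/andP=> /eqP <- _; rewrite /= !phiE.
exists S; split.
  move=> H HF [phi [inj [out iso]]].
  have Hpos := H0 H HF; have Hc := max_order_ge HF.
  pose o := Ordinal Hpos.
  (* Out of range [insubd] returns [o], so the entries from [gn H] on repeat the first one, the
     padding that [bad_for] asks for. *)
  pose t := mkseq (fun i => val (phi (insubd o i))) c.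
  have tE (i : 'I_(gn H)) : nth 0 t i = phi i.
    rewrite nth_mkseq; last exact: leq_trans Hc.
    by congr (val (phi _)); apply: val_inj; rewrite val_insubd ltn_ord.
  have t_in x : x \in t -> exists i, x = phi i.
    by move=> /mapP[i _ ->]; exists (insubd o i).
  have tT : t \in tuples n c.
    rewrite mem_tuples size_mkseq eqxx; apply/allP => x /t_in[i ->]; exact: ltn_ord.
  have bt : bad F c adj t.
    apply/has_graph; exists H => //; apply/and3P; split=> //.
      apply/forallP => i; apply/forallP => j; rewrite !tE adjE iso eqxx /=.
      by apply/implyP; apply: contraNN => /eqP/val_inj/inj->.
    apply/allP => j; rewrite mem_iota => /andP[lj jlt]; apply/eqP.
    rewrite !nth_mkseq; try lia; congr (val (phi _)); apply: val_inj.
    by rewrite !val_insubd Hpos ltnNge lj.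
  have szT s : s \in tuples n c -> size s = c by rewrite mem_tuples => /andP[/eqP].
  have /hasP[x /t_in[i ->] /mapP[v]] := kept_hits Dk szT hitK tT bt.
  by rewrite mem_enum => vS /val_inj vE; have := out i; rewrite inE vE vS.
(* A core vertex of S' has fewer than k neighbours: otherwise its first k
   neighbours survive and, with the vertex itself, exceed the budget k. *)
have deg i : i \in S' -> core F n k c adj (embed i) ->
    count (adj (embed i)) (iota 0 n) < k.
  move=> iS ci; rewrite ltnNge; apply/negP => kdeg.
  pose E := [seq v <- iota 0 n | early k adj (embed i) v].
  have szE : size E = k by rewrite size_early; apply/minn_idPl.
  have : size (val (embed i) :: E) <= size [seq val (embed j) | j <- enum (closed_nbhd G' S')].
    apply: uniq_leq_size.
      rewrite cons_uniq filter_uniq ?iota_uniq // andbT mem_filter /early adjE.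
      by case: simpleG => _ ->.
    move=> v; rewrite inE => /predU1P[->|].
      by apply/mapP; exists i; rewrite // mem_enum inE iS.
    rewrite mem_filter mem_iota => /andP[e /= vn].
    have [|j jE] := @embed_onto (Ordinal vn).
      apply/orP; right; apply/hasP; exists (val (embed i)); last by rewrite ci.
      by rewrite mem_iota ltn_ord.
    apply/mapP; exists j; last exact: esym (congr1 val jE).
    rewrite mem_enum !inE; apply/orP; right; apply/existsP; exists i.
    by rewrite iS adj_survivor jE -adjE; case/andP: e.
  by rewrite size_map -cardE /= szE => h; have := leq_trans h le'; rewrite ltnn.
apply: leq_trans le'; rewrite -(card_imset _ embed_inj); apply: subset_leq_card.
apply/subsetP => v; rewrite !inE => /orP[/imsetP[i]|/existsP[w /andP[/imsetP[i]]]].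
  by rewrite inE => /andP[iS _] ->; apply: imset_f; rewrite inE iS.
rewrite inE => /andP[iS ci] -> a.
have [|j jE] := @embed_onto v.
  apply/orP; right; apply/hasP; exists (val (embed i)); first by rewrite mem_iota ltn_ord.
  (* With fewer than [k] neighbours altogether, every neighbour is early and hence survives. *)
  rewrite ci /early adjE a /=; apply: leq_ltn_trans (deg i iS ci).
  have -> : iota 0 n = iota 0 v ++ iota v (n - v).
    by have := iotaD 0 v (n - v); rewrite add0n subnKC // ltnW.
  by rewrite count_cat leq_addr.
rewrite -jE; apply: imset_f; rewrite !inE; apply/orP; right; apply/existsP.
by exists i; rewrite iS adj_survivor jE.
Qed.

End Equivalence.

(** * The kernel program *)

(** Disjunctions may take values above 1, so truth is being nonzero; [EBool] normalises to 0 or 1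
    where values are counted. *)
Definition evalb (M : nat -> bool) (r : nat -> nat) (e : exp) : bool := eval M r e != 0.

Definition ENot (e : exp) : exp := EEq e (ENum 0).
Definition EBool (e : exp) : exp := ELt (ENum 0) e.
Definition EAnd (es : seq exp) : exp := foldr EMul (ENum 1) es.
Definition EOr (es : seq exp) : exp := foldr EAdd (ENum 0) es.
Definition EPow (e : exp) (n : nat) : exp := iter n (EMul e) (ENum 1).

Lemma sum_seq_neq0 (T : Type) (f : T -> nat) (s : seq T) :
  (\sum_(i <- s) f i != 0) = has (fun i => f i != 0) s.
Proof. by elim: s => [|x s IH]; rewrite ?big_nil // big_cons /= addn_eq0 negb_and IH. Qed.

Lemma sum_seq_count (T : Type) (P : pred T) (s : seq T) :
  \sum_(i <- s) (P i : nat) = count P s.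
Proof. by elim: s => [|x s IH]; rewrite ?big_nil // big_cons /= IH. Qed.

Section EvalLemmas.

Variables (M : nat -> bool) (r : nat -> nat).

Lemma evalb_not e : evalb M r (ENot e) = ~~ evalb M r e.
Proof. by rewrite /evalb /= eqb0 /evalb negbK. Qed.

Lemma eval_bool e : eval M r (EBool e) = evalb M r e.
Proof. by rewrite /evalb /= lt0n. Qed.

Lemma evalb_mul e1 e2 : evalb M r (EMul e1 e2) = evalb M r e1 && evalb M r e2.
Proof. by rewrite /evalb /= muln_eq0 negb_or. Qed.

Lemma evalb_add e1 e2 : evalb M r (EAdd e1 e2) = evalb M r e1 || evalb M r e2.
Proof. by rewrite /evalb /= addn_eq0 negb_and. Qed.

Lemma evalb_eq e1 e2 : evalb M r (EEq e1 e2) = (eval M r e1 == eval M r e2).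
Proof. by rewrite /evalb /= eqb0 negbK. Qed.

Lemma evalb_lt e1 e2 : evalb M r (ELt e1 e2) = (eval M r e1 < eval M r e2).
Proof. by rewrite /evalb /= eqb0 negbK. Qed.

Lemma evalb_bit e : evalb M r (EBit e) = M (eval M r e).
Proof. by rewrite /evalb /= eqb0 negbK. Qed.

Lemma evalb_and es : evalb M r (EAnd es) = all (evalb M r) es.
Proof. by elim: es => //= e es IH; rewrite evalb_mul IH. Qed.

Lemma evalb_or es : evalb M r (EOr es) = has (evalb M r) es.
Proof. by elim: es => //= e es IH; rewrite evalb_add IH. Qed.

Lemma eval_pow e n : eval M r (EPow e n) = eval M r e ^ n.
Proof. by elim: n => //= n ->; rewrite expnS. Qed.

Lemma eval_sum x e b :
  eval M r (ESum x e b) = \sum_(i <- iota 0 (eval M r e)) eval M (fset r x i) b.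
Proof. by rewrite /= -(big_mkord xpredT (fun i => eval M (fset r x i) b)) /index_iota subn0. Qed.

Lemma evalb_sum x e b : evalb M r (ESum x e b)
  = has (fun i => evalb M (fset r x i) b) (iota 0 (eval M r e)).
Proof. by rewrite /evalb eval_sum sum_seq_neq0. Qed.

End EvalLemmas.

Fixpoint bind (r : nat -> nat) (b : nat) (s : seq nat) : nat -> nat :=
  if s is x :: s' then bind (fset r b x) b.+1 s' else r.

Lemma bind_lt r b s y : y < b -> bind r b s y = r y.
Proof.
elim: s r b => //= x s IH r b lt; rewrite IH ?fset_ne //; lia.
Qed.

Lemma bind_nth r b s i : i < size s -> bind r b s (b + i) = nth 0 s i.
Proof.
elim: s r b i => //= x s IH r b [|i] lt /=.
  by rewrite addn0 bind_lt // fset_eq.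
by rewrite -addSnnS IH.
Qed.

(** One nested sum per coordinate. Variable 2 holds the number of vertices, so lemmas require
    [2 < b] lest a binding overwrite it. *)
Fixpoint ESums (b c : nat) (e : exp) : exp :=
  if c is c'.+1 then ESum b (EVar 2) (ESums b.+1 c' e) else e.

Lemma eval_sums M r b c e : 2 < b ->
  eval M r (ESums b c e) = \sum_(s <- tuples (r 2) c) eval M (bind r b s) e.
Proof.
elim: c b r => [|c IH] b r b2; first by rewrite big_seq1.
rewrite [ESums _ _ _]/= eval_sum big_allpairs_dep; apply: eq_bigr => i _.
by rewrite IH; [rewrite fset_ne //; lia|lia].
Qed.

Lemma evalb_sums M r b c e : 2 < b ->
  evalb M r (ESums b c e) = has (fun s => evalb M (bind r b s) e) (tuples (r 2) c).
Proof. by move=> b2; rewrite /evalb eval_sums // sum_seq_neq0. Qed.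

Fixpoint PFors (b c : nat) (p : prog) : prog :=
  if c is c'.+1 then PFor b (EVar 2) (PFors b.+1 c' p) else p.

Lemma run_fors b c p r st : 2 < b ->
  run (PFors b c p) r st = foldl (fun st s => run p (bind r b s) st) st (tuples (r 2) c).
Proof.
elim: c b r st => [|c IH] b r st b2 //=.
elim: (iota 0 (r 2)) st => //= i l IHl st.
rewrite foldl_cat -IHl IH; last by lia.
congr foldl; rewrite fset_ne; last by lia.
by elim: (tuples _ c) st => //= s l' -> .
Qed.

(** A tuple read as a number in base [n]; it serves as the address of the tuple in the bit array. *)
Definition horner (n : nat) (s : seq nat) : nat := foldl (fun a x => a * n + x) 0 s.

Lemma horner_inj n s t : size s = size t -> all (ltn^~ n) s -> all (ltn^~ n) t ->
  horner n s = horner n t -> s = t.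
Proof.
rewrite /horner; elim/last_ind: s t => [|s x IH] t; first by case: t.
case/lastP: t => [|t y]; first by rewrite size_rcons.
rewrite !size_rcons !all_rcons !foldl_rcons => -[sz] /andP[xn sn] /andP[yn tn] E.
have n0 : 0 < n by apply: leq_ltn_trans xn.
have E1 := congr1 (divn^~ n) E; have E2 := congr1 (modn^~ n) E.
rewrite /= !divnMDl // !divn_small // !addn0 in E1.
rewrite /= !modnMDl !modn_small // in E2.
by rewrite E2 (IH t).
Qed.

Fixpoint ECode (b c : nat) (acc : exp) : exp :=
  if c is c'.+1 then ECode b.+1 c' (EAdd (EMul acc (EVar 2)) (EVar b)) else acc.

Lemma eval_code M r b s acc : (forall i, i < size s -> r (b + i) = nth 0 s i) ->
  eval M r (ECode b (size s) acc) = foldl (fun a x => a * r 2 + x) (eval M r acc) s.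
Proof.
elim: s b acc => //= x s IH b acc h; rewrite IH /=.
  by have := h 0 erefl; rewrite addn0 => ->.
by move=> i lt; rewrite addSnnS h.
Qed.

Lemma uniq_tuples n c : uniq (tuples n c).
Proof.
elim: c => //= c IH; apply: allpairs_uniq; rewrite ?iota_uniq //.
by move=> [x s] [y t] _ _ /= [-> ->].
Qed.

(** The array records a set; without repetitions, counting in it agrees with counting in the
    list. *)
Lemma kept_uniq c k bd ts : uniq ts -> uniq (kept c k bd ts).
Proof.
elim/last_ind: ts => // ts t IH; rewrite rcons_uniq kept_rcons => /andP[tn u].
rewrite /keep; case: ifP => _ /=; last exact: IH.
by rewrite IH // andbT; apply: contra tn => /kept_sub[].
Qed.

(* Variable 0 holds the input length, 1 and 2 hold k and n. *)
Definition k_exp : exp :=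
  ESum 3 (EVar 0) (ENot (ESum 4 (EAdd (EVar 3) (ENum 1)) (ENot (EBit (EVar 4))))).

(** Counts the addresses from which on all input bits are true. As the memory is reversed, these are
    the leading true bits of the encoding, ended by the separator. *)
Definition n_exp : exp :=
  ESum 3 (EVar 0) (ENot (ESum 4 (EVar 0)
    (EMul (ELt (EVar 3) (EAdd (EVar 4) (ENum 1))) (ENot (EBit (EVar 4)))))).

(* The memory holds the input reversed, so the bit of the edge (u, v) is at
   the address p with p + (u * n + v + 1) = k + n * n. *)
Definition adj_exp (y z : nat) : exp :=
  ESum 6 (EVar 0) (EMul
    (EEq (EAdd (EVar 6) (EAdd (EAdd (EMul (EVar y) (EVar 2)) (EVar z)) (ENum 1)))
         (EAdd (EVar 1) (EMul (EVar 2) (EVar 2))))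
    (EBit (EVar 6))).

(** * Decoding the instance from the memory *)

Section Reading.

Variables (n k : nat) (mat : seq bool).
Hypothesis size_mat : size mat = n * n.
Hypothesis last_mat : nth false (false :: mat) (n * n) = false.

Let x := nseq n true ++ false :: mat ++ nseq k true.
Let L := size x.

Lemma size_input : L = n + (n * n + k).+1.
Proof. by rewrite /L /x size_cat /= size_cat !size_nseq size_mat. Qed.

(** Nothing is required from address [L] on, where the kept tuples will be recorded. *)
Definition holds_input (M : nat -> bool) : Prop :=
  forall i, i < L -> M i = nth false (rev x) i.

Lemma holds_input_k M i : holds_input M -> i < k -> M i.
Proof.
move=> h lt; have sL := size_input; rewrite h; last by lia.
rewrite nth_rev -/L; last by lia.
rewrite /x nth_cat size_nseq ifF; last by lia.
have -> : L - i.+1 - n = (n * n + (k - i.+1)).+1 by lia.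
by rewrite /= nth_cat size_mat ifF; [rewrite nth_nseq ifT //|]; lia.
Qed.

(** Address [k] holds the last matrix bit, or the separator if [n = 0]; being false, it ends the run
    of true bits that encodes [k]. *)
Lemma holds_input_sep M : holds_input M -> M k = false.
Proof.
move=> h; have sL := size_input; rewrite h; last by lia.
rewrite nth_rev -/L; last by lia.
rewrite /x nth_cat size_nseq ifF; last by lia.
have -> : L - k.+1 - n = n * n by lia.
by rewrite -cat_cons nth_cat /= size_mat ltnS leqnn last_mat.
Qed.

Lemma holds_input_n M i : holds_input M -> L - n <= i < L -> M i.
Proof.
move=> h lt; have sL := size_input; rewrite h; last by lia.
rewrite nth_rev -/L; last by lia.
by rewrite /x nth_cat size_nseq ifT; [rewrite nth_nseq ifT //|]; lia.
Qed.

Lemma holds_input_sep' M : holds_input M -> M (L - n.+1) = false.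
Proof.
move=> h; have sL := size_input; rewrite h; last by lia.
rewrite nth_rev -/L; last by lia.
have -> : L - (L - n.+1).+1 = n by lia.
by rewrite /x nth_cat size_nseq ltnn subnn.
Qed.

Lemma holds_input_adj M u v : holds_input M -> u < n -> v < n ->
  M (k + n * n - (u * n + v).+1) = nth false mat (u * n + v).
Proof.
move=> h un vn; have sL := size_input.
have lt : u * n + v < n * n by nia.
rewrite h; last by lia.
rewrite nth_rev -/L; last by lia.
have -> : L - (k + n * n - (u * n + v).+1).+1 = n + (u * n + v).+1 by lia.
rewrite /x nth_cat size_nseq ifF; last by lia.
by rewrite addKn /= nth_cat size_mat lt.
Qed.

Lemma eval_k M r : holds_input M -> r 0 = L -> eval M r k_exp = k.
Proof.
move=> h r0; have sL := size_input; rewrite eval_sum /= r0.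
(* The index [i] counts iff no bit up to and including [i] is false, that is, iff [i < k]. *)
have -> : \sum_(i <- iota 0 L) ((\sum_(i0 < i + 1) (M i0 == 0 :> nat) == 0) : nat)
    = \sum_(i <- iota 0 L) ((i < k) : nat).
  apply: eq_bigr => i _; congr nat_of_bool.
  rewrite sum_nat_eq0; apply/forallP/idP => [H|ik j].
    rewrite ltnNge; apply/negP => ki.
    have lt : k < i + 1 by lia.
    by have := H (Ordinal lt); rewrite /= (holds_input_sep h).
  by case: j => j lt; rewrite [nat_of_ord _]/= (holds_input_k h) //; lia.
rewrite sum_seq_count -size_filter.
have -> : iota 0 L = iota 0 k ++ iota k (L - k).
  by have := iotaD 0 k (L - k); rewrite add0n subnKC //; lia.
rewrite filter_cat size_cat (eq_in_filter (a2 := predT)) ?filter_predT ?size_iota.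
  rewrite (eq_in_filter (a2 := pred0)) ?filter_pred0 ?addn0 // => i.
  by rewrite mem_iota /=; lia.
by move=> i; rewrite mem_iota.
Qed.

Lemma eval_n M r : holds_input M -> r 0 = L -> eval M r n_exp = n.
Proof.
move=> h r0; have sL := size_input; rewrite eval_sum /= /fset /= r0.
have -> : \sum_(i <- iota 0 L)
      ((\sum_(j < L) (i < j + 1) * (M j == 0 :> nat) == 0) : nat)
    = \sum_(i <- iota 0 L) ((L - n <= i) : nat).
  apply: eq_bigr => i _; congr nat_of_bool.
  rewrite sum_nat_eq0; apply/forallP/idP => [H|ik j].
    rewrite leqNgt; apply/negP => ki.
    have lt : L - n.+1 < L by lia.
    have := H (Ordinal lt); rewrite /= (holds_input_sep' h) /= muln1.
    by case: ltnP => //; lia.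
  case: j => j lt; rewrite [nat_of_ord _]/=; case: ltnP => // ij.
  by rewrite (holds_input_n h) //; lia.
rewrite sum_seq_count -size_filter.
have -> : iota 0 L = iota 0 (L - n) ++ iota (L - n) n.
  by have := iotaD 0 (L - n) n; rewrite add0n subnK //; lia.
rewrite filter_cat size_cat [X in _ + size X](eq_in_filter (a2 := predT)) ?filter_predT ?size_iota.
  rewrite (eq_in_filter (a2 := pred0)) ?filter_pred0 // => i.
  by rewrite mem_iota /=; lia.
by move=> i; rewrite mem_iota => /andP[].
Qed.

(** Expressions have no subtraction; the sum over all addresses singles out the one solving the
    address equation. The variables must differ from 6, the summation variable, to avoid capture. *)
Lemma eval_adj M r y z : holds_input M -> r 0 = L -> r 1 = k -> r 2 = n ->
  y != 6 -> z != 6 -> r y < n -> r z < n ->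
  eval M r (adj_exp y z) = nth false mat (r y * n + r z).
Proof.
move=> h r0 r1 r2 y6 z6 yn zn; have sL := size_input.
have lt : r y * n + r z < n * n by nia.
rewrite [LHS]/= r0.
have plt : k + n * n - (r y * n + r z).+1 < L by lia.
rewrite (bigD1 (Ordinal plt)) //= big1 ?addn0.
  rewrite /fset /= (negbTE y6) (negbTE z6) r1 r2 (holds_input_adj h) //.
  by case: eqP => [_|]; [rewrite mul1n|lia].
move=> i /eqP ne; rewrite /fset /= (negbTE y6) (negbTE z6) r1 r2.
case: eqP => // E; case: ne; apply: val_inj => /=; lia.
Qed.

End Reading.

Lemma run_if e p q r st :
  run (PIf e p q) r st = if evalb st.1 r e then run p r st else run q r st.
Proof. by []. Qed.

Lemma run_seq p q r st : run (PSeq p q) r st = run q r (run p r st).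
Proof. by []. Qed.

Lemma run_let y e p r st : run (PLet y e p) r st = run p (fset r y (eval st.1 r e)) st.
Proof. by []. Qed.

(* Variables 3 and 4 range over vertices, 5 to 7 are auxiliary, and the tuples
   under consideration occupy the c variables from 10 and from 10 + c on. *)
Section KernelProgram.

Variables (F : seq graph) (c : nat).

Definition pair_exp (H : graph) (b : nat) (i j : 'I_(gn H)) : exp :=
  EMul (EEq (adj_exp (b + i) (b + j)) (ENum (gadj H i j)))
       (if i == j then ENum 1 else ENot (EEq (EVar (b + i)) (EVar (b + j)))).

Definition bad_for_exp (b : nat) (H : graph) : exp :=
  if gn H == 0 then ENum 0 else
  EMul (EAnd [seq EAnd [seq pair_exp b i j | j <- enum 'I_(gn H)] | i <- enum 'I_(gn H)])
       (EAnd [seq EEq (EVar (b + j)) (EVar b) | j <- iota (gn H) (c - gn H)]).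

Definition bad_exp (b : nat) : exp := EOr [seq bad_for_exp b H | H <- F].

Definition code_exp (b : nat) : exp := EAdd (EVar 0) (ECode b c (ENum 0)).

Definition agree_exp (b b' : nat) (I : {set 'I_c}) : exp :=
  EAnd [seq EEq (EVar (b + i)) (EVar (b' + i)) | i : 'I_c <- enum I].

Definition count_exp (I : {set 'I_c}) : exp :=
  ESums (10 + c) c (EBool (EMul (EBit (code_exp (10 + c))) (agree_exp 10 (10 + c) I))).

Definition cap_exp (I : {set 'I_c}) : exp :=
  EPow (EMul (ENum c) (EAdd (EVar 1) (ENum 1))) (c - #|I|).

Definition admissible_exp : exp :=
  EMul (bad_exp 10)
    (EAnd [seq ELt (count_exp J) (cap_exp J) | J : {set 'I_c} <- enum {: {set 'I_c}}]).

Definition core_exp (y : nat) : exp :=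
  ESums 10 c (EMul (EBit (code_exp 10)) (EOr [seq EEq (EVar y) (EVar (10 + i)) | i <- iota 0 c])).

Definition selected_exp (y : nat) : exp :=
  EAdd (core_exp y) (ESum 5 (EVar 2) (EMul (core_exp 5)
    (EMul (adj_exp 5 y) (ELt (ESum 7 (EVar y) (adj_exp 5 7)) (EVar 1))))).

Definition keep_prog : prog :=
  PFors 10 c (PIf admissible_exp (PSet (code_exp 10)) PSkip).

Definition output_prog : prog :=
  PSeq (PFor 3 (EVar 2) (PIf (selected_exp 3) (PPush true) PSkip))
  (PSeq (PPush false)
  (PSeq (PFor 3 (EVar 2) (PIf (selected_exp 3)
          (PFor 4 (EVar 2) (PIf (selected_exp 4)
            (PIf (adj_exp 3 4) (PPush true) (PPush false)) PSkip)) PSkip))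
    (PFor 3 (EVar 1) (PPush true)))).

Definition kernel_prog : prog :=
  PLet 1 k_exp (PLet 2 n_exp (PSeq keep_prog output_prog)).

End KernelProgram.

(** * Correctness of the kernel program *)

Section KernelRun.

Variables (F : seq graph) (c n k : nat) (mat : seq bool).
Hypothesis order_le : forall H, List.In H F -> gn H <= c.
Hypothesis size_mat : size mat = n * n.
Hypothesis last_mat : nth false (false :: mat) (n * n) = false.

Let x := nseq n true ++ false :: mat ++ nseq k true.
Let L := size x.
Let adj : rel nat := fun u v => nth false mat (u * n + v).
Let T := tuples n c.

Definition env_good (r : nat -> nat) : Prop := [/\ r 0 = L, r 1 = k & r 2 = n].

Definition reads (r : nat -> nat) (b : nat) (t : seq nat) : Prop :=
  forall i, i < size t -> r (b + i) = nth 0 t i.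

Lemma env_good_fset r y v : 2 < y -> env_good r -> env_good (fset r y v).
Proof. by move=> y2 [r0 r1 r2]; split; rewrite fset_ne //; lia. Qed.

Lemma env_good_bind r b s : 2 < b -> env_good r -> env_good (bind r b s).
Proof. by move=> y2 [r0 r1 r2]; split; rewrite bind_lt //; lia. Qed.

Lemma tuple_size t : t \in T -> size t = c.
Proof. by rewrite mem_tuples => /andP[/eqP]. Qed.

Lemma tuple_lt t i : t \in T -> i < c -> nth 0 t i < n.
Proof.
by rewrite mem_tuples => /andP[/eqP st /(all_nthP 0) h] lt; apply: h; rewrite st.
Qed.

Lemma all_enum (A : finType) (P : pred A) : all P (enum A) = [forall a, P a].
Proof.
apply/allP/forallP => [h a|h a _]; last exact: h.
by apply: h; rewrite mem_enum.
Qed.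

Lemma has_In (P Q : pred graph) (s : seq graph) :
  (forall H, List.In H s -> P H = Q H) -> has P s = has Q s.
Proof.
elim: s => //= H s IH h; rewrite h; last by left.
by rewrite IH // => H' i; apply: h; right.
Qed.

Lemma evalb_adj M r y z : holds_input n k mat M -> env_good r -> y != 6 -> z != 6 ->
  r y < n -> r z < n -> evalb M r (adj_exp y z) = adj (r y) (r z).
Proof.
move=> h [r0 r1 r2] y6 z6 yn zn.
by rewrite /evalb (eval_adj size_mat last_mat h) // eqb0 negbK.
Qed.

Lemma evalb_bad M r b t : holds_input n k mat M -> env_good r -> 6 < b ->
  t \in T -> reads r b t -> evalb M r (bad_exp F c b) = bad F c adj t.
Proof.
move=> h g b6 tT rd; have st := tuple_size tT.
rewrite evalb_or has_map; apply: has_In => H /order_le Hc.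
rewrite /= /bad_for_exp /bad_for; case: posnP => [//|Hpos].
have rdi i : i < gn H -> r (b + i) = nth 0 t i by move=> lt; apply: rd; rewrite st; lia.
rewrite evalb_mul !evalb_and /=; congr andb.
  rewrite all_map all_enum; apply: eq_forallb => i.
  rewrite /= evalb_and all_map all_enum; apply: eq_forallb => j.
  have ni := tuple_lt tT (leq_trans (ltn_ord i) Hc).
  have nj := tuple_lt tT (leq_trans (ltn_ord j) Hc).
  rewrite /= /pair_exp evalb_mul evalb_eq; case: g => r0 r1 r2.
  rewrite (eval_adj size_mat last_mat h) ?rdi //; try lia.
  rewrite /= -/(adj _ _).
  congr andb; first by case: (adj _ _); case: (gadj H i j).
  by case: eqP => //= _; rewrite evalb_not evalb_eq /= !rdi.
rewrite all_map; apply: eq_in_all => j; rewrite mem_iota => /andP[j1 j2] /=.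
rewrite evalb_eq /= rd; last by rewrite st; lia.
by have := rdi 0 Hpos; rewrite addn0 => ->.
Qed.

Definition holds_tuples (K : seq (seq nat)) (M : nat -> bool) : Prop :=
  forall s, s \in T -> M (L + horner n s) = (s \in K).

Lemma eval_code_exp M r b s : env_good r -> s \in T -> reads r b s ->
  eval M r (code_exp c b) = L + horner n s.
Proof.
move=> [r0 r1 r2] sT rd; rewrite /= r0 -(tuple_size sT) eval_code //.
by rewrite r2.
Qed.

Lemma evalb_kept K M r b s : env_good r -> holds_tuples K M -> s \in T -> reads r b s ->
  evalb M r (EBit (code_exp c b)) = (s \in K).
Proof.
by move=> g hK sT rd; rewrite evalb_bit (eval_code_exp M g sT rd) hK.
Qed.

Lemma reads_bind r b s : reads (bind r b s) b s.
Proof. by move=> i; exact: bind_nth. Qed.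

Lemma reads_bind_lt r b b' t s : reads r b t -> b + size t <= b' -> reads (bind r b' s) b t.
Proof. by move=> rd le i lt; rewrite bind_lt ?rd //; lia. Qed.

Lemma evalb_agree M r b b' (I : {set 'I_c}) t s : t \in T -> s \in T ->
  reads r b t -> reads r b' s -> evalb M r (agree_exp b b' I) = agree I t s.
Proof.
move=> tT sT rt rs; rewrite /agree_exp evalb_and all_map.
apply/allP/forall_inP => [h i iI|h i].
  have /= := h i; rewrite mem_enum iI evalb_eq /= => /(_ isT).
  by rewrite rt ?rs ?(tuple_size tT) ?(tuple_size sT).
rewrite mem_enum /= => iI; rewrite evalb_eq /= rt ?rs ?(tuple_size tT) ?(tuple_size sT) //.
exact: h.
Qed.

(** The expression runs through all of [T] and tests the recorded bit; as [K] is a duplicate-free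
    part of [T], this counts the same tuples. *)
Lemma eval_count K M r (I : {set 'I_c}) t : env_good r -> holds_tuples K M -> uniq K ->
  {subset K <= T} -> t \in T -> reads r 10 t ->
  eval M r (count_exp I) = agree_count K I t.
Proof.
move=> g hK uK sK tT rt; have [_ _ r2] := g.
rewrite /count_exp eval_sums // r2 -/T big_seq.
have -> : \sum_(s <- T | s \in T) eval M (bind r (10 + c) s)
      (EBool (EMul (EBit (code_exp c (10 + c))) (agree_exp 10 (10 + c) I)))
    = \sum_(s <- T | s \in T) (((s \in K) && agree I t s) : nat).
  apply: eq_bigr => s sT; rewrite eval_bool evalb_mul.
  have g' : env_good (bind r (10 + c) s) by exact: env_good_bind.
  have rs := @reads_bind r (10 + c) s.
  rewrite (evalb_kept g' hK sT rs) (evalb_agree _ _ tT sT) //.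
  by apply: reads_bind_lt => //; rewrite (tuple_size tT).
rewrite -big_seq sum_seq_count /agree_count -!size_filter.
apply: perm_size; apply: uniq_perm; rewrite ?filter_uniq ?uniq_tuples //.
move=> s; rewrite !mem_filter /= andbC; case: (boolP (s \in K)) => [/sK->|]; rewrite ?andbF ?andbT //.
Qed.

Lemma evalb_admissible K M r t : holds_input n k mat M -> env_good r ->
  holds_tuples K M -> uniq K -> {subset K <= T} -> t \in T -> reads r 10 t ->
  evalb M r (admissible_exp F c) = admissible c k (bad F c adj) K t.
Proof.
move=> h g hK uK sK tT rt; have [_ r1 _] := g.
rewrite evalb_mul (evalb_bad h g _ tT) // evalb_and all_map all_enum.
congr andb; apply: eq_forallb => I.
by rewrite /= evalb_lt (eval_count I g hK uK sK tT rt) eval_pow /= r1 addn1.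
Qed.

Let K := kept_tuples F n k c adj.

Lemma run_keep M r : holds_input n k mat M -> env_good r -> (forall i, L <= i -> M i = false) ->
  exists M', [/\ run (keep_prog F c) r (M, [::]) = (M', [::]),
    holds_input n k mat M' & holds_tuples K M'].
Proof.
move=> h g hM; have [_ _ r2] := g.
rewrite /keep_prog run_fors // r2 -/T /K /kept_tuples -/T.
(* Prepares an induction over prefixes of [T]: the included list varies, while [T] stays on the
   right and in [holds_tuples]. *)
have : {subset T <= T} by [].
have : uniq T by exact: uniq_tuples.
elim/last_ind: {-3}T => [|ts t IH].
  move=> _ _; exists M; split=> // s sT; rewrite hM //; lia.
rewrite rcons_uniq => /andP[tn u] sub.
have [||M' [E h' hK]] := IH => //; first by move=> s sts; apply: sub; rewrite mem_rcons inE sts orbT.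
have tT : t \in T by apply: sub; rewrite mem_rcons mem_head.
rewrite foldl_rcons E kept_rcons run_if.
have g' := @env_good_bind r 10 t erefl g.
have rt := @reads_bind r 10 t.
have sK : {subset kept c k (bad F c adj) ts <= T}.
  by move=> s /kept_sub[sts _]; apply: sub; rewrite mem_rcons inE sts orbT.
rewrite [_.1]/= (evalb_admissible h' g' hK (kept_uniq _ _ _ u) sK tT rt).
rewrite /keep; case: ifP => _; last by exists M'.
have idx := eval_code_exp M' g' tT rt.
(* The new bit lies behind the input and, by [horner_inj], belongs to no other tuple of [T]. *)
exists (fset M' (L + horner n t) true); split.
- by rewrite -idx.
- by move=> i lt; rewrite fset_ne ?h' //; rewrite -/x -/L in lt; lia.
- move=> s sT; rewrite inE; case: eqP => [->|ne]; first by rewrite fset_eq.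
  rewrite fset_ne ?hK // => /addnI/horner_inj; rewrite !(tuple_size _) // => E'.
  move: sT tT; rewrite !mem_tuples => /andP[_ a1] /andP[_ a2].
  by apply: ne; apply: E'.
Qed.

Lemma evalb_core M r y : env_good r -> holds_tuples K M -> y < 10 ->
  evalb M r (core_exp c y) = core F n k c adj (r y).
Proof.
move=> g hK y10; have [_ _ r2] := g.
rewrite /core_exp evalb_sums // r2 -/T /core -/K.
have memE s : s \in T -> evalb M (bind r 10 s) (EMul (EBit (code_exp c 10))
    (EOr [seq EEq (EVar y) (EVar (10 + i)) | i <- iota 0 c])) = (s \in K) && (r y \in s).
  move=> sT; have rs := @reads_bind r 10 s.
  rewrite evalb_mul (evalb_kept (env_good_bind _ _ g) hK sT rs) //; congr andb.
  rewrite evalb_or has_map -[X in iota 0 X](tuple_size sT).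
  apply/hasP/(nthP 0) => [[i]|[i lt E]].
    rewrite mem_iota /= evalb_eq /= bind_lt // => /= lt /eqP ->.
    by exists i; rewrite // bind_nth.
  exists i; first by rewrite mem_iota.
  by rewrite /= evalb_eq /= bind_lt // bind_nth // E.
apply/hasP/hasP => -[s sT]; first by rewrite memE // => /andP[sK ys]; exists s.
move=> ys; have sT' : s \in T by have [] := kept_sub sT.
by exists s => //; rewrite memE // sT.
Qed.

(** Variables 3 and 4 are those of the output loops; they escape capture by the auxiliary variables
    5 to 7 and by the tuple block from 10 on. *)
Lemma evalb_selected M r y : holds_input n k mat M -> env_good r -> holds_tuples K M ->
  y \in [:: 3; 4] -> r y < n ->
  evalb M r (selected_exp c y) = selected F n k c adj (r y).
Proof.
move=> h g hK y34 yn; have [_ r1 r2] := g.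
have y10 : y < 10 by move: y34; rewrite !inE => /orP[]/eqP->.
have y5 : y <> 5 by move: y34; rewrite !inE => /orP[]/eqP->.
have y6 : y != 6 by move: y34; rewrite !inE => /orP[]/eqP->.
rewrite evalb_add evalb_core // evalb_sum; congr orb.
rewrite [eval _ _ _]/= r2; apply: eq_in_has => w; rewrite mem_iota => /andP[_ /= wn].
set r' := fset r 5 w.
have g' : env_good r' by exact: env_good_fset.
have [_ r1' r2'] := g'.
have e5 : r' 5 = w by rewrite /r' fset_eq.
have ey : r' y = r y by rewrite /r' fset_ne.
rewrite !evalb_mul evalb_core // e5 /early evalb_adj ?e5 ?ey //; congr [&& _, _ & _].
rewrite evalb_lt [eval M r' (EVar 1)]/= r1' eval_sum [eval M r' (EVar y)]/= ey.
congr (_ < _); rewrite -sum_seq_count; rewrite big_seq [RHS]big_seq.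
apply: eq_bigr => v; rewrite mem_iota add0n => vy.
have [r0'' r1'' r2''] := @env_good_fset r' 7 v erefl g'.
by rewrite (eval_adj size_mat last_mat h) // ?fset_eq ?fset_ne ?e5 //; lia.
Qed.

(** While output is written the memory stays fixed, so each round appends a word that depends on its
    index alone. *)
Lemma run_for_push M r y e p (g : nat -> seq bool) :
  (forall i o, i < eval M r e -> run p (fset r y i) (M, o) = (M, o ++ g i)) ->
  forall o, run (PFor y e p) r (M, o) = (M, o ++ flatten [seq g i | i <- iota 0 (eval M r e)]).
Proof.
move=> /= H; set N := eval M r e in H *.
have : forall i, i \in iota 0 N -> i < N by move=> i; rewrite mem_iota.
elim: (iota 0 N) => [|i l IH] hl o /=; first by rewrite cats0.
rewrite H; last by apply: hl; rewrite mem_head.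
by rewrite IH ?catA // => j jl; apply: hl; rewrite inE jl orbT.
Qed.

Lemma flatten_if (A : Type) (P : pred nat) (g : nat -> seq A) (s : seq nat) :
  flatten [seq if P i then g i else [::] | i <- s] = flatten [seq g i | i <- s & P i].
Proof. by elim: s => //= i s IH; case: (P i); rewrite /= IH. Qed.

Let us := survivors F n k c adj.

Lemma flatten_singletons (A : eqType) (f : nat -> A) (s : seq nat) :
  flatten [seq [:: f i] | i <- s] = map f s.
Proof. by elim: s => //= i s ->. Qed.

Lemma run_output M r : holds_input n k mat M -> env_good r -> holds_tuples K M ->
  (run (output_prog c) r (M, [::])).2 =
  nseq (size us) true ++ false :: [seq adj u v | u <- us, v <- us] ++ nseq k true.
Proof.
move=> h g hK; have [_ r1 r2] := g.
pose sel := selected F n k c adj.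
have run_if_sel r' y p o (w : seq bool) : env_good r' -> y \in [:: 3; 4] -> r' y < n ->
   run p r' (M, o) = (M, o ++ w) ->
   run (PIf (selected_exp c y) p PSkip) r' (M, o) = (M, o ++ if sel (r' y) then w else [::]).
  move=> g' y34 yn E; rewrite run_if [_.1]/= evalb_selected // -/(sel _).
  by case: (sel _); rewrite ?cats0.
rewrite [output_prog c]/output_prog.
set p1 := PFor 3 (EVar 2) (PIf _ (PPush true) _).
set p2 := PFor 3 (EVar 2) _.
set p3 := PFor 3 (EVar 1) _.
have R1 o : run p1 r (M, o) = (M, o ++ nseq (size us) true).
  rewrite (@run_for_push _ _ _ _ _ (fun i => if sel i then [:: true] else [::])).
    rewrite /= r2 flatten_if (flatten_singletons (fun=> true)) -/us.
    by congr (_, _ ++ _); rewrite /us /survivors; elim: (filter _ _) => //= ? ? ->.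
  move=> i o'; rewrite [eval _ _ _]/= r2 => lt.
  rewrite (run_if_sel _ _ _ _ [:: true]) ?fset_eq ?cats1 //; exact: env_good_fset.
have R2 o : run p2 r (M, o) = (M, o ++ [seq adj u v | u <- us, v <- us]).
  rewrite (@run_for_push _ _ _ _ _
    (fun u => if sel u then [seq adj u v | v <- us] else [::])).
    by rewrite /= r2 flatten_if.
  move=> u o'; rewrite [eval _ _ _]/= r2 => ltu.
  set r' := fset r 3 u; have g' : env_good r' by exact: env_good_fset.
  have [_ _ r2'] := g'.
  have e3 : r' 3 = u by rewrite /r' fset_eq.
  rewrite (run_if_sel _ _ _ _ [seq adj u v | v <- us]) ?e3 //.
  rewrite (@run_for_push _ _ _ _ _ (fun v => if sel v then [:: adj u v] else [::])).
    by rewrite /= r2' flatten_if flatten_singletons.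
  move=> v o2; rewrite [eval _ _ _]/= r2' => ltv.
  set r'' := fset r' 4 v; have g'' : env_good r'' by exact: env_good_fset.
  have e4 : r'' 4 = v by rewrite /r'' fset_eq.
  have e3' : r'' 3 = u by rewrite /r'' fset_ne.
  rewrite (run_if_sel _ _ _ _ [:: adj u v]) ?e4 //.
  rewrite run_if [_.1]/= evalb_adj ?e3' ?e4 //.
  by case: (adj u v); rewrite cats1.
have R3 o : run p3 r (M, o) = (M, o ++ nseq k true).
  rewrite (@run_for_push _ _ _ _ _ (fun=> [:: true])); last by move=> i o' _; rewrite /= cats1.
  rewrite /= r1 (flatten_singletons (fun=> true)); congr (_, _ ++ _).
  by rewrite -[in RHS](size_iota 0 k); elim: (iota 0 k) => //= ? ? ->.
by rewrite !run_seq R1 [run (PPush _) _ _]/= R2 R3 /= -cats1 -!catA.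
Qed.

Lemma run_kernel_prog : 
  (run (kernel_prog F c) (length_env (size x)) (nth false (rev x), [::])).2 =
  nseq (size us) true ++ false :: [seq adj u v | u <- us, v <- us] ++ nseq k true.
Proof.
set M := nth false (rev x).
have h : holds_input n k mat M by [].
rewrite /kernel_prog !run_let run_seq ![_.1]/=.
rewrite (eval_k size_mat last_mat h) //.
rewrite (eval_n size_mat last_mat h) //.
set r := fset _ 2 _.
have g : env_good r by [].
have [i iL|M' [E h' hK]] := run_keep h g; first by rewrite /M nth_default // size_rev.
by rewrite E (run_output h' g hK).
Qed.

End KernelRun.

(** * The encoding of graphs and the final assembly *)

Definition adjacency_bits (G : graph) : seq bool :=
  [seq gadj G i j | i <- enum 'I_(gn G), j <- enum 'I_(gn G)].

Lemma nth_allpairs_row (S T A : Type) (f : S -> T -> A) (a0 : A) (x0 : S) (y0 : T) s t i j :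
  i < size s -> j < size t ->
  nth a0 [seq f x y | x <- s, y <- t] (i * size t + j) = f (nth x0 s i) (nth y0 t j).
Proof.
elim: s i => //= x s IH [|i] lt jt; rewrite nth_cat size_map.
  by rewrite mul0n add0n jt (nth_map y0).
by rewrite mulSn -addnA ltnNge leq_addr /= addKn IH.
Qed.

Lemma nth_adjacency_bits (G : graph) (u v : 'I_(gn G)) :
  nth false (adjacency_bits G) (u * gn G + v) = gadj G u v.
Proof.
have := @nth_allpairs_row _ _ _ (gadj G) false u v (enum 'I_(gn G)) (enum 'I_(gn G)) u v.
by rewrite size_enum_ord !nth_ord_enum; exact.
Qed.

Lemma size_adjacency_bits (G : graph) : size (adjacency_bits G) = gn G * gn G.
Proof. by rewrite size_allpairs !size_enum_ord. Qed.

(** The last entry of the matrix is on the diagonal, so the absence of loops makes it false. This is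
    what separates the matrix from the unary [k] behind it. *)
Lemma last_adjacency_bit (G : graph) : simple G ->
  nth false (false :: adjacency_bits G) (gn G * gn G) = false.
Proof.
case=> _ irr; case: (posnP (gn G)) => [->//|n0].
have lt : (gn G).-1 < gn G by rewrite prednK.
have -> : gn G * gn G = ((gn G).-1 * gn G + (gn G).-1).+1 by nia.
by have := nth_adjacency_bits (Ordinal lt) (Ordinal lt); rewrite irr.
Qed.

Lemma enc_survivor_graph F n k c adj :
  enc_instance (survivor_graph F n k c adj) k
  = let us := survivors F n k c adj in
    nseq (size us) true ++ false :: [seq adj u v | u <- us, v <- us] ++ nseq k true.
Proof.
rewrite /enc_instance /=; set us := survivors F n k c adj; congr (_ ++ _ :: _ ++ _).
have e : us = [seq nth 0 us i | i : 'I_(size us) <- enum 'I_(size us)].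
  by rewrite -[LHS](mkseq_nth 0) /mkseq -val_enum_ord -map_comp.
by rewrite [in RHS]e allpairs_mapl allpairs_mapr.
Qed.

Theorem theorem9 (F : seq graph) :
  (forall H, List.In H F -> simple H) ->
  has_kernel_with_vertex_bound F (max_order F).+1.
Proof.
move=> _; set c := max_order F.
have [M [a [d comp]]] := prog_computes (kernel_prog F c).
(* The constant comes from rewriting c (c (k+1))^c (k+1) as c c^c (k+1)^(c+1); the budget is
   unchanged, so [id] bounds it. *)
exists M, a, d, (c * c ^ c), id => G k sG.
pose adj u v := nth false (adjacency_bits G) (u * gn G + v).
exists (survivor_graph F (gn G) k c adj), k; split=> //.
- by apply: simple_survivor_graph => // u v; exact: nth_adjacency_bits.
- have := comp (enc_instance G k).
  rewrite (run_kernel_prog k (@max_order_ge F) (size_adjacency_bits G) (last_adjacency_bit sG)).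
  by rewrite enc_survivor_graph.
- split; first exact: (secluded_survivor (@nth_adjacency_bits G)).
  exact: (survivor_secluded sG (@nth_adjacency_bits G)).
- apply: leq_trans (size_survivors _ _ _ _ _) _.
  by rewrite expnMn mulnA -mulnA -expnSr.
Qed.
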